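(* Every double-critical $7$-chromatic graph $G$ contains $K_7$ as a minor.
   Context: All graphs are finite and simple. A graph $G$ is (vertex-)critical if $\chi(G-v)<\chi(G)$ for every vertex $v\in V(G)$. A critical graph $G$ is double-critical if $\chi(G-x-y)\le\chi(G)-2$ for every edge $xy\in E(G)$. $K_n$ denotes the complete graph on $n$ vertices. A graph $H$ is a minor of $G$ if $H$ can be obtained from $G$ by deleting edges and/or vertices and contracting edges. *)

(* Defs.v *)
From mathcomp Require Import all_boot.
Set Implicit Arguments. Unset Strict Implicit. Unset Printing Implicit Defensive.

(* A finite simple graph is a finType T of vertices with an edge relation
   e : rel T that is symmetric and irreflexive. Induced subgraphs are
   given by vertex sets S : {set T}. *)

Definition simple_graph (T : finType) (e : rel T) : Prop :=
  symmetric e /\ irreflexive e.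

Definition colorableb (T : finType) (e : rel T) (S : {set T}) (k : nat) : bool :=
  [exists f : {ffun T -> 'I_k},
     [forall x, forall y,
        [&& x \in S, y \in S, x != y & e x y] ==> (f x != f y)]].

Lemma colorable_card (T : finType) (e : rel T) (S : {set T}) :
  exists k, colorableb e S k.
Proof.
exists #|T|; apply/existsP; exists [ffun x => enum_rank x].
apply/forallP => x; apply/forallP => y; apply/implyP => /and4P [_ _ nxy _].
by rewrite !ffunE; apply: contra nxy => /eqP /enum_rank_inj ->.
Qed.

Definition chi (T : finType) (e : rel T) (S : {set T}) : nat :=
  ex_minn (colorable_card e S).

Definition critical (T : finType) (e : rel T) : Prop :=
  forall v : T, chi e (setT :\ v) < chi e setT.

Definition double_critical (T : finType) (e : rel T) : Prop :=
  critical e /\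
  forall x y : T, e x y -> chi e (setT :\ x :\ y) <= chi e setT - 2.

Definition connected_in (T : finType) (e : rel T) (S : {set T}) : Prop :=
  forall x y, x \in S -> y \in S ->
    connect [rel u v | [&& e u v, u \in S & v \in S]] x y.

Definition minor (U : finType) (h : rel U) (T : finType) (e : rel T) : Prop :=
  exists B : U -> {set T},
    [/\ forall u, B u != set0,
        forall u v, u != v -> [disjoint B u & B v],
        forall u, connected_in e (B u) &
        forall u v, h u v -> exists x y, [/\ x \in B u, y \in B v & e x y]].

Definition complete_rel (n : nat) : rel 'I_n := fun i j => i != j.

(* Main.v *)
Require Import Defs.
From mathcomp Require Import all_boot.
From mathcomp Require Import zify.
Set Implicit Arguments. Unset Strict Implicit. Unset Printing Implicit Defensive.

(** Each edge of a double-critical 7-chromatic graph lies in at least five triangles; this alone forces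
    a [K_7] minor.  Suppose not.  Among the vertex sets [X] whose boundary [S] has at most nine vertices
    and is attached to a connected set [Y] outside [X :|: S], take a smallest one.  Contracting [Y] into
    [S] and using Mader's bound (at most [5 n - 15] edges) for the graph on [X :|: S], one finds in [X]
    a vertex of degree at most nine; minimality then forces [X] to be a clique completely joined to
    [S], so the neighbourhood [H] of a vertex of [X] has six to nine vertices, minimum degree at least
    five, and all its non-universal vertices in [S].  Unless [H] is complete, some non-universal [v] of
    [H] leaves a [K_5] minor in [H :\ v] (by the analogous bound [3 n - 6] for [K_5]), and this minor
    together with [v |: Y] and a vertex of [X] is a [K_7] minor.  A minor-minimal counterexample to
    Mader's bound has all edges in five triangles too, so the same argument proves that bound. *)

(** * Complete minors as sequences of branch sets *)

Section Models.
Variables (T : finType).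
Implicit Types (e : rel T) (A B W X Y : {set T}) (s : seq {set T}).

Definition touches e A B := [exists x in A, exists y in B, e x y].

Definition separate_touching e A B := [disjoint A & B] && touches e A B.

(** A [K_k] minor of the graph induced on [W], with branch sets [s]. The vertex type stays fixed
    while [e] and [W] vary, so that deletions and contractions stay inside one type. *)
Definition hasK k e W : Prop :=
  exists s : seq {set T},
    [/\ size s = k, pairwise (separate_touching e) s &
        forall A, A \in s -> [/\ A != set0, A \subset W & connected_in e A]].

Lemma touchesP e A B :
  reflect (exists x y, [/\ x \in A, y \in B & e x y]) (touches e A B).
Proof.
apply: (iffP exists_inP) => [[x xA /exists_inP [y yB xy]]|[x [y [xA yB xy]]]].
  by exists x, y.
by exists x => //; apply/exists_inP; exists y.
Qed.

Lemma touches_sym e A B : symmetric e -> touches e A B = touches e B A.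
Proof.
by move=> se; apply/touchesP/touchesP => -[x [y [? ? xy]]]; exists y, x; rewrite se.
Qed.

Lemma separate_touching_sym e A B :
  symmetric e -> separate_touching e A B = separate_touching e B A.
Proof. by move=> se; rewrite /separate_touching disjoint_sym touches_sym. Qed.

Lemma connected_in1 e x : connected_in e [set x].
Proof. by move=> a b /set1P -> /set1P ->; apply: connect0. Qed.

Lemma connected_in_sub e A x y B :
  A \subset B ->
  connect [rel u v | [&& e u v, u \in A & v \in A]] x y ->
  connect [rel u v | [&& e u v, u \in B & v \in B]] x y.
Proof.
move=> /subsetP sAB; apply: connect_sub => u v /and3P [uv uA vA].
by apply: connect1; rewrite /= uv !sAB.
Qed.

Lemma connect_rel_sym e A : symmetric e ->
  connect_sym [rel u v | [&& e u v, u \in A & v \in A]].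
Proof.
move=> se; apply: sym_connect_sym => x y.
by rewrite /= se; case: (x \in A); rewrite ?andbF ?andbT.
Qed.

(** A [g]-path in [S] lifts: within each [F z] one moves by connectedness, and each edge of the path
    supplies a crossing edge. *)
Lemma connected_in_bigcup (U : finType) (g : rel U) (S : {set U}) (F : U -> {set T}) e :
  symmetric e -> connected_in g S ->
  (forall x, x \in S -> connected_in e (F x)) ->
  {in S &, forall x y, g x y -> touches e (F x) (F y)} ->
  connected_in e (\bigcup_(x in S) F x).
Proof.
move=> se cS cF tF a b /bigcupP [x xS aFx] /bigcupP [y yS bFy].
set R := [rel u v | _].
have inF z c d : z \in S -> c \in F z -> d \in F z -> connect R c d.
  move=> zS cz dz; apply: connected_in_sub (cF z zS _ _ cz dz).
  exact: (bigcup_sup z).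
have step : forall p z c, z \in S -> c \in F z ->
    path [rel u v | [&& g u v, u \in S & v \in S]] z p ->
    last z p = y -> connect R c b.
  elim=> [|z' p IH] z c zS cz /=; first by move=> _ zy; subst z; apply: inF bFy.
  move=> /andP [/and3P [zz' _ z'S] pp] lp.
  have /touchesP [c1 [c2 [c1z c2z c12]]] := tF _ _ zS z'S zz'.
  apply: (connect_trans (inF _ _ _ zS cz c1z)).
  apply: connect_trans (IH z' c2 z'S c2z pp lp).
  have inU z0 c0 : z0 \in S -> c0 \in F z0 -> c0 \in \bigcup_(x in S) F x.
    by move=> ? ?; apply/bigcupP; exists z0.
  by apply: connect1; rewrite /R /= c12 (inU z) ?(inU z').
have /connectP [p pp lp] := cS x y xS yS.
exact: step pp (esym lp).
Qed.

Lemma connected_inU e A B :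
  symmetric e -> connected_in e A -> connected_in e B -> touches e A B ->
  connected_in e (A :|: B).
Proof.
move=> se cA cB tAB.
have -> : A :|: B = \bigcup_(x in [set: bool]) (if x then A else B).
  by rewrite (big_setD1 true) ?inE //= (big_setD1 false) ?inE //= big1 ?setU0 // => -[]; rewrite !inE.
apply: (connected_in_bigcup (g := fun x y => x != y)) => //.
- move=> x y _ _; case: (eqVneq x y) => [->|nxy]; first exact: connect0.
  by apply: connect1; rewrite /= nxy !inE.
- by move=> [].
- by move=> [] [] _ _ //; rewrite touches_sym.
Qed.

Lemma hasK_sub k e e' W W' :
  hasK k e W -> W \subset W' -> {in W &, forall x y, e x y -> e' x y} -> hasK k e' W'.
Proof.
move=> [s [sz pw sP]] sW see; exists s; split => //.
  apply: (sub_in_pairwise (P := mem s)) pw; last exact/allP.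
  move=> A B /sP [_ /subsetP AW _] /sP [_ /subsetP BW _] /andP [dAB /touchesP [x [y [xA yB xy]]]].
  rewrite /separate_touching dAB; apply/touchesP; exists x, y; split=> //; apply: see => //; [exact: AW | exact: BW].
move=> A /sP [A0 AW cA]; split=> //; first exact: subset_trans AW sW.
move=> x y xA yA; apply: connect_sub (cA x y xA yA) => u v /and3P [uv uA vA].
by apply: connect1; rewrite /= uA vA see // (subsetP AW).
Qed.

End Models.

(** Minors compose: the union of the sets [F x] over a branch set for [g] is a branch set for
    [e]. *)
Lemma hasK_blowup (U T : finType) (g : rel U) (e : rel T) (F : U -> {set T}) k
    (W : {set U}) (W' : {set T}) :
  symmetric e -> hasK k g W ->
  (forall x, x \in W -> [/\ F x != set0, F x \subset W' & connected_in e (F x)]) ->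
  {in W &, forall x y, x != y -> [disjoint F x & F y]} ->
  {in W &, forall x y, g x y -> touches e (F x) (F y)} ->
  hasK k e W'.
Proof.
move=> se [s [sz pw sP]] FP dF tF.
exists [seq \bigcup_(x in A) F x | A : {set U} <- s]; split; first by rewrite size_map.
  rewrite pairwise_map; apply: (sub_in_pairwise (P := mem s)) pw; last exact/allP.
  move=> A B As Bs /= /andP [dAB /touchesP [x [y [xA yB xy]]]].
  have [_ AW _] := sP _ As; have [_ BW _] := sP _ Bs.
  apply/andP; split.
    rewrite -setI_eq0; apply/eqP/setP => t; rewrite !inE; apply/negP => /andP [/bigcupP [u uA tu] /bigcupP [v vB tv]].
    have uv : u != v by apply: contraTneq vB => <-; rewrite (disjointFr dAB uA).
    by have := dF u v (subsetP AW _ uA) (subsetP BW _ vB) uv; rewrite disjoint_subset => /subsetP /(_ t tu); rewrite inE tv.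
  have /touchesP [a [b [ax byy ab]]] := tF _ _ (subsetP AW _ xA) (subsetP BW _ yB) xy.
  by apply/touchesP; exists a, b; split=> //; apply/bigcupP; [exists x | exists y].
move=> _ /mapP [A As ->]; have [A0 AW cA] := sP A As; have {}AW := subsetP AW; split.
- case/set0Pn: A0 => x xA; have [/set0Pn [t tx] _ _] := FP x (AW _ xA).
  by apply/set0Pn; exists t; apply/bigcupP; exists x.
- by apply/bigcupsP => x /AW /FP [].
- apply: (connected_in_bigcup (g := g)) => // [x /AW /FP [] //|x y xA yA]; apply: tF; exact: AW.
Qed.

Lemma hasK_minor (T : finType) (e : rel T) k W : symmetric e ->
  hasK k e W -> minor (@complete_rel k) e.
Proof.
move=> se [s [sz pw sP]]; subst k; exists (fun i : 'I_(size s) => nth set0 s i).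
have tri (i j : 'I_(size s)) : i != j -> separate_touching e (nth set0 s i) (nth set0 s j).
  have /pairwiseP := pw => /(_ set0) h; rewrite neq_ltn => /orP [] ij.
    exact: (h _ _ (ltn_ord i) (ltn_ord j) ij).
  by rewrite separate_touching_sym //; exact: (h _ _ (ltn_ord j) (ltn_ord i) ij).
split.
- by move=> i; have [] := sP _ (mem_nth set0 (ltn_ord i)).
- by move=> i j /tri /andP [].
- by move=> i; have [] := sP _ (mem_nth set0 (ltn_ord i)).
- by move=> i j /tri /andP [_ /touchesP].
Qed.

(** * Degree sums and contractions *)

Section Degrees.
Variable (T : finType).
Implicit Types (e : rel T) (v x y : T) (M W Y : {set T}).

Definition nbs e W x := [set y in W | e x y].
(** Twice the number of edges induced on [W]; all edge bounds are stated in this doubled form. *)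
Definition esum e W := \sum_(x in W) #|nbs e W x|.
(** Models the contraction of a connected set into [v]: the vertices of [M] gain [v] as a
    neighbour. *)
Definition addstar e v M : rel T :=
  fun x y => [|| e x y, (x == v) && (y \in M) | (y == v) && (x \in M)].

Lemma in_nbs e W x y : (y \in nbs e W x) = (y \in W) && e x y.
Proof. by rewrite inE. Qed.

Lemma nbs_sub e W x : nbs e W x \subset W.
Proof. by apply/subsetP => y; rewrite in_nbs => /andP []. Qed.

Lemma sum_mem W M : M \subset W -> \sum_(x in W) (x \in M) = #|M|.
Proof.
move=> /subsetP sM; rewrite -sum1_card (big_mkcond (mem M)) [RHS](bigID (mem W)) /=.
rewrite [X in _ + X]big1 ?addn0; last by move=> x xW; case: ifP => // /sM; rewrite (negPf xW).
by apply: eq_bigr => x _; case: (x \in M).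
Qed.

Lemma addstar_sym e v M : symmetric e -> symmetric (addstar e v M).
Proof. by move=> se x y; rewrite /addstar se orbC orbA orbC -!orbA [X in _ || X]orbC. Qed.

Lemma addstar_irr e v M : irreflexive e -> v \notin M -> irreflexive (addstar e v M).
Proof.
by move=> ie vM x; rewrite /addstar ie orbb /=; apply: contraNF vM => /andP [/eqP ->].
Qed.

Lemma esum_addstar e v M W : symmetric e -> v \in W -> M \subset W -> v \notin M ->
  [disjoint M & nbs e W v] -> esum (addstar e v M) W = esum e W + #|M|.*2.
Proof.
move=> se vW sM vM dM.
have E x : x \in W ->
    #|nbs (addstar e v M) W x| = #|nbs e W x| + (if x == v then #|M| else x \in M).
  move=> xW; case: (eqVneq x v) => [->|xv].
    rewrite -cardsUI addnC.
    have -> : nbs e W v :&: M = set0 by apply/eqP; rewrite setIC setI_eq0.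
    rewrite cards0 add0n; apply: eq_card => y; rewrite !inE /addstar eqxx /= (negPf vM) andbF orbF.
    by case: (boolP (y \in M)) => [/(subsetP sM) ->|_]; rewrite ?orbT ?orbF.
  case: (boolP (x \in M)) => [xM|xM]; last first.
    by rewrite addn0; apply: eq_card => y; rewrite !inE /addstar (negPf xv) (negPf xM) andbF !orbF.
  have -> : nbs (addstar e v M) W x = v |: nbs e W x.
    by apply/setP => y; rewrite !inE /addstar (negPf xv) xM andbT /=; case: (eqVneq y v) => [->|_]; rewrite ?vW ?orbT ?orbF.
  rewrite cardsU1 addnC in_nbs vW se.
  have := disjointFr dM xM; rewrite in_nbs xW /= => ->; lia.
rewrite /esum (eq_bigr _ E) big_split /=; congr (_ + _).
rewrite (bigD1 v) //= eqxx (eq_bigr (fun x => nat_of_bool (x \in M))); last by move=> x /andP [_ /negPf ->].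
have := sum_mem sM; rewrite (bigD1 v) //= (negPf vM) add0n => ->; lia.
Qed.

Lemma nbs_D1 e W v x : #|nbs e W x| = #|nbs e (W :\ v) x| + ((v \in W) && e x v).
Proof.
rewrite (cardsD1 v (nbs e W x)) in_nbs addnC; congr (_ + _).
by apply: eq_card => y; rewrite !inE andbA.
Qed.

Lemma esum_D1 e W v : symmetric e -> irreflexive e -> v \in W ->
  esum e W = esum e (W :\ v) + #|nbs e W v|.*2.
Proof.
move=> se ie vW; rewrite /esum (big_setD1 v) //=.
rewrite (eq_bigr (fun x => #|nbs e (W :\ v) x| + (x \in nbs e W v))); last first.
  move=> x; rewrite in_setD1 => /andP [_ xW].
  by rewrite (nbs_D1 e W v) vW in_nbs xW se.
rewrite big_split /= sum_mem; first lia.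
by apply/subsetP => y; rewrite !inE => /andP [-> vy]; rewrite andbT; apply: contraTneq vy => ->; rewrite ie.
Qed.

(** Deleting a vertex lowers [esum] by twice its degree. This parity settles the extreme case of the
    separator count. *)
Lemma esum_even e W : symmetric e -> irreflexive e -> ~~ odd (esum e W).
Proof.
move=> se ie; have [n] := ubnP #|W|; elim: n W => // n IH W Wn.
have [->|[v vW]] := set_0Vmem W; first by rewrite /esum big_set0.
rewrite (esum_D1 se ie vW) oddD odd_double addbF; apply: IH.
by have := cardsD1 v W; rewrite vW; lia.
Qed.

Lemma nbs_irr e W v : irreflexive e -> v \notin nbs e W v.
Proof. by move=> ie; rewrite in_nbs ie andbF. Qed.

(** Blowing [v] up to [v |: Y] realises every added edge, because each vertex of [M] has a neighbour
    in [Y]. *)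
Lemma hasK_contract k e v M W Y W' : symmetric e -> v \in W ->
  connected_in e Y -> touches e [set v] Y -> [disjoint W & Y] ->
  (forall x, x \in M -> touches e [set x] Y) ->
  W :|: Y \subset W' ->
  hasK k (addstar e v M) W -> hasK k e W'.
Proof.
move=> se vW cY vY dWY MY; rewrite subUset => /andP [sW sY] hK.
have nv x : x \in W -> x \notin Y by move=> xW; rewrite (disjointFr dWY xW).
pose F x := if x == v then v |: Y else [set x].
apply: (hasK_blowup (F := F) se hK) => [x xW|x y xW yW xy|x y xW yW]; rewrite /F.
- case: (x =P v) => _; split.
  + by apply/set0Pn; exists v; rewrite setU11.
  + by rewrite subUset sub1set (subsetP sW).
  + by apply: connected_inU => //; exact: connected_in1.
  + by apply/set0Pn; exists x; rewrite set11.
  + by rewrite sub1set (subsetP sW).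
  + exact: connected_in1.
- have [xv|xv] := eqVneq x v.
    by subst x; rewrite eq_sym (negPf xy) disjoint_sym disjoints1 !inE negb_or nv // eq_sym xy.
  by rewrite disjoints1; case: (eqVneq y v) => yv; rewrite !inE ?negb_or ?nv // -?yv xy.
rewrite /addstar; case: (eqVneq x v) => [->|xv]; case: (eqVneq y v) => [->|yv] /=.
- case/or3P => [vv|vM|vM].
  + by apply/touchesP; exists v, v; rewrite !setU11.
  + have /touchesP [a [b [/set1P -> bY ab]]] := MY _ vM.
    by apply/touchesP; exists v, b; rewrite setU11 setU1r.
  + have /touchesP [a [b [/set1P -> bY ab]]] := MY _ vM.
    by apply/touchesP; exists v, b; rewrite setU11 setU1r.
- rewrite orbF => /orP [vy|yM].
    by apply/touchesP; exists v, y; rewrite setU11 set11.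
  have /touchesP [a [b [/set1P -> bY ab]]] := MY _ yM.
  by apply/touchesP; exists b, y; rewrite setU1r ?set11 // se.
- case/orP => [vy|xM].
    by apply/touchesP; exists x, v; rewrite setU11 set11.
  have /touchesP [a [b [/set1P -> bY ab]]] := MY _ xM.
  by apply/touchesP; exists x, b; rewrite setU1r ?set11.
- by rewrite orbF => xy; apply/touchesP; exists x, y; rewrite !set11.
Qed.

(** Contracting [b] into [a] loses the edge itself and, for each common neighbour, one of two edges
    that merge; [esum] counts each loss twice. *)
Lemma contract_edge k e W a b : symmetric e -> irreflexive e ->
  a \in W -> b \in W -> e a b -> ~ hasK k e W ->
  exists e', [/\ symmetric e', irreflexive e', ~ hasK k e' (W :\ b) &
    esum e W = esum e' (W :\ b) + #|nbs e W a :&: nbs e W b|.*2 + 2].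
Proof.
move=> se ie aW bW ab nK; pose M := nbs e W b :\ a :\: nbs e W a.
have ba : b != a by apply: contraTneq ab => ->; rewrite ie.
have aM : a \notin M by rewrite !inE eqxx /= andbF.
have aWb : a \in W :\ b by rewrite !inE eq_sym ba.
exists (addstar e a M); split; [exact: addstar_sym|exact: addstar_irr| |].
- apply: contra_not nK; apply: (hasK_contract (Y := [set b])) => //.
  + exact: connected_in1.
  + by apply/touchesP; exists a, b; rewrite !set11.
  + by rewrite disjoint_sym disjoints1 !inE eqxx.
  + move=> x; rewrite !inE => /and4P [_ _ _ bx].
    by apply/touchesP; exists x, b; rewrite !set11 se.
  + by rewrite subUset subD1set sub1set.
- rewrite esum_addstar //; last 2 first.
  + apply/subsetP => x; rewrite !inE => /and4P [_ _ xW bx]; rewrite xW andbT.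
    by apply: contraTneq bx => ->; rewrite ie.
  + rewrite disjoint_sym disjoint_subset; apply/subsetP => x; rewrite !inE => /andP [/andP [_ xW] ax].
    by rewrite xW ax.
  rewrite (esum_D1 se ie bW).
  have := cardsID (nbs e W a) (nbs e W b :\ a).
  have := cardsD1 a (nbs e W b); rewrite in_nbs aW se ab /= -/M.
  have -> : (nbs e W b :\ a) :&: nbs e W a = nbs e W a :&: nbs e W b.
    by apply/setP => x; rewrite !inE; case: (eqVneq x a) => [->|]; rewrite ?ie ?andbF //= andbC.
  lia.
Qed.

End Degrees.

(** * Minimal counterexamples to linear edge bounds *)

Section Extremal.
Variable (T : finType).
Implicit Types (e : rel T) (u v x y : T) (N W : {set T}).

Lemma nbs_lt e W x : irreflexive e -> x \in W -> #|nbs e W x| < #|W|.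
Proof.
move=> ie xW; apply: proper_card; rewrite properE nbs_sub /=.
by apply/subsetPn; exists x; rewrite // nbs_irr.
Qed.

Lemma esum_ge e W d : (forall x, x \in W -> d <= #|nbs e W x|) -> d * #|W| <= esum e W.
Proof. by move=> h; rewrite mulnC -sum_nat_const; apply: leq_sum => x /h. Qed.

Lemma esum_delete_edge e W a b : symmetric e -> irreflexive e ->
  a \in W -> b \in W -> e a b ->
  exists e0, [/\ symmetric e0, irreflexive e0, subrel e0 e & esum e W = esum e0 W + 2].
Proof.
move=> se ie aW bW ab.
pose e0 : rel T := fun x y => e x y && ~~ ((x == a) && (y == b) || (x == b) && (y == a)).
have ba : b != a by apply: contraTneq ab => ->; rewrite ie.
have s0 : symmetric e0 by move=> x y; rewrite /e0 se orbC [(x == b) && _]andbC [(x == a) && _]andbC.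
exists e0; split=> //; first by move=> x; rewrite /e0 ie.
  by move=> x y /andP [].
(* The deleted edge is put back as a star with one ray, so the count for [addstar] applies. *)
have <- : esum (addstar e0 a [set b]) W = esum e W.
  apply: eq_bigr => x _; apply: eq_card => y; rewrite !inE /addstar !inE; congr (_ && _).
  rewrite /e0; case: (eqVneq x a) => xa; case: (eqVneq y b) => yb;
    case: (eqVneq x b) => xb; case: (eqVneq y a) => ya; try subst x; try subst y;
    rewrite ?eqxx ?(negPf xa) ?(negPf xb) ?(negPf ya) ?(negPf yb) /= ?andbT ?andbF ?orbF ?orbT //;
    solve [by rewrite se ab | by case/eqP: ba; congruence].
rewrite esum_addstar ?cards1 ?sub1set ?inE 1?eq_sym //.
by rewrite disjoints1 !inE /e0 !eqxx /= !andbF.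
Qed.

(** The bound is [c n - d/2] edges; the first premise checks it on complete graphs with [n0]
    vertices. A counterexample minimal in vertices, then in edges, has no isolated vertex, has every
    edge in at least [c] triangles and exceeds the bound by at most one edge; the second premise
    finds the minor there. *)
Lemma extremal_induction k c d n0 : n0 * n0.-1 + d <= 2 * c * n0 ->
  (forall e W, symmetric e -> irreflexive e -> n0 < #|W| ->
     (forall x, x \in W -> nbs e W x != set0) ->
     {in W &, forall x y, e x y -> c <= #|nbs e W x :&: nbs e W y|} ->
     esum e W + d <= 2 * c * #|W| + 2 ->
     (forall e' W', symmetric e' -> irreflexive e' -> n0 <= #|W'| -> #|W'| < #|W| ->
        ~ hasK k e' W' -> esum e' W' + d <= 2 * c * #|W'|) ->
     hasK k e W) ->
  forall e W, symmetric e -> irreflexive e -> n0 <= #|W| -> ~ hasK k e W ->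
    esum e W + d <= 2 * c * #|W|.
Proof.
move=> base step e W; have [n] := ubnP #|W|; elim: n e W => // n IHn e W Wn.
have [m] := ubnP (esum e W); elim: m e => // m IHm e em se ie nW nK.
have IH e' W' : symmetric e' -> irreflexive e' -> n0 <= #|W'| -> #|W'| < #|W| ->
    ~ hasK k e' W' -> esum e' W' + d <= 2 * c * #|W'|.
  by move=> ? ? ? lt ?; apply: IHn => //; lia.
have [W0|] := eqVneq #|W| n0.
  rewrite W0; apply: leq_trans base; rewrite leq_add2r -{1}W0 -sum_nat_const.
  by apply: leq_sum => x xW; have := nbs_lt ie xW; lia.
move=> nW0; have {nW0}nW : n0 < #|W| by lia.
have [//|big] := leqP (esum e W + d) (2 * c * #|W|).
exfalso; apply: (nK); apply: step => //.
(* Deleting an isolated vertex keeps [esum] while the bound falls by [2 * c]. *)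
- move=> x xW; apply/negP => /eqP x0.
  have := esum_D1 se ie xW; rewrite x0 cards0 addn0 => E.
  have W1 := cardsD1 x W; rewrite xW add1n in W1; rewrite W1 mulnS in big.
  have nK' : ~ hasK k e (W :\ x).
    by apply: contra_not nK => h; apply: (hasK_sub h) => //; exact: subD1set.
  have : n0 <= #|W :\ x| by lia.
  by move=> /(IH e (W :\ x) se ie) /(_ _ nK'); lia.
(* With fewer than [c] common neighbours, contraction lowers [esum] by at most [2 * c], so the
   smaller graph would still violate the bound. *)
- move=> x y xW yW xy; have [//|lt] := leqP c.
  have [e' [se' ie' nK' E]] := contract_edge se ie xW yW xy nK.
  have W1 := cardsD1 y W; rewrite yW add1n in W1; rewrite W1 mulnS in big.
  have : n0 <= #|W :\ y| by lia.
  by move=> /(IH e' (W :\ y) se' ie') /(_ _ nK'); lia.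
(* Deleting one edge lowers [esum] by 2 and restores the bound; without edges the base inequality
   suffices. *)
- have [E|] := boolP [exists x in W, exists y in W, e x y].
    have /exists_inP [a aW /exists_inP [b bW ab]] := E.
    have [e0 [se0 ie0 sub E0]] := esum_delete_edge se ie aW bW ab.
    have nK0 : ~ hasK k e0 W.
      by apply: contra_not nK => h; apply: (hasK_sub h) => // ? ? _ _; exact: sub.
    have := IHm e0 _ se0 ie0 (ltnW nW) nK0; lia.
  move=> /exists_inPn h; have : esum e W = 0.
    apply: big1 => z /h /exists_inPn h2; apply: eq_card0 => t; rewrite inE.
    by apply/negP => /andP [/h2 /negPf ->].
  by have := leq_mul (leqnn (2 * c)) (ltnW nW); lia.
Qed.

End Extremal.

(** * Cliques and wheels on five vertices *)

Section FiveCliques.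
Variable (T : finType).
Implicit Types (e : rel T) (u v x y : T) (A N W C : {set T}).

Lemma touches1 e x A : touches e [set x] A = [exists y in A, e x y].
Proof.
apply/touchesP/exists_inP => [[_ [y [/set1P -> yA xy]]]|[y yA xy]]; first by exists y.
by exists x, y; rewrite set11.
Qed.

Lemma separate_touching1 e x A :
  separate_touching e [set x] A = (x \notin A) && [exists y in A, e x y].
Proof. by rewrite /separate_touching disjoints1 touches1. Qed.

Lemma separate_touching11 e x y : irreflexive e ->
  separate_touching e [set x] [set y] = e x y.
Proof.
move=> ie; rewrite separate_touching1 inE; apply/andP/idP => [[_ /exists_inP [z /set1P ->]] //|xy].
split; first by apply: contraTneq xy => ->; rewrite ie.
by apply/exists_inP; exists y; rewrite ?set11.
Qed.

Lemma hasK_clique e W C : irreflexive e -> C \subset W ->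
  {in C &, forall x y, x != y -> e x y} -> hasK #|C| e W.
Proof.
move=> ie CW cC; exists [seq [set x] | x <- enum C]; split.
- by rewrite size_map cardE.
- rewrite pairwise_map; have := enum_uniq C; rewrite uniq_pairwise.
  apply: (sub_in_pairwise (P := mem C)); last by apply/allP => x; rewrite mem_enum.
  by move=> x y xC yC xy; rewrite /= separate_touching11 // cC.
- move=> _ /mapP [x + ->]; rewrite mem_enum => xC; split.
  + by apply/set0Pn; exists x; rewrite set11.
  + by rewrite sub1set (subsetP CW).
  + exact: connected_in1.
Qed.

Lemma card_size (s : seq T) N : uniq s -> {subset s <= N} -> size s <= #|N|.
Proof.
by move=> us sN; rewrite -(card_uniqP us); apply: subset_leq_card; apply/subsetP.
Qed.

Lemma nonneighbors_le e W x (s : seq T) : uniq s ->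
  {subset s <= W} -> {in s, forall y, ~~ e x y} -> size s + #|nbs e W x| <= #|W|.
Proof.
move=> us sW ns; rewrite -(cardsID (nbs e W x) W) addnC.
rewrite (setIidPr (nbs_sub e W x)) leq_add2l; apply: card_size => // y ys.
by rewrite !inE negb_and sW // ns // orbT.
Qed.

(* The second alternative is a wheel with hub [q] and rim [a b a' b']; the status of [b b'] is left open. *)
Lemma clique_or_wheel e N : symmetric e -> irreflexive e -> #|N| = 5 ->
  (forall x, x \in N -> 3 <= #|nbs e N x|) ->
  {in N &, forall x y, x != y -> e x y} \/
  exists a a' q b b', [/\ uniq [:: a; a'; q; b; b'], N =i [:: a; a'; q; b; b'],
     ~~ e a a', [/\ e a q, e a b & e a b'] &
     [/\ e a' q, e a' b, e a' b', e q b & e q b']].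
Proof.
move=> se ie N5 dN.
(* Degree at least three among five vertices allows at most one non-neighbour besides [x] itself. *)
have nn x y z : x \in N -> y \in N -> z \in N -> uniq [:: x; y; z] -> ~~ e x y -> e x z.
  move=> xN yN zN us xy; apply: contraT => xz.
  have sN : {subset [:: x; y; z] <= N} by move=> t; rewrite !inE => /or3P [] /eqP ->.
  have nt : {in [:: x; y; z], forall t, ~~ e x t}.
    by move=> t; rewrite !inE => /or3P [] /eqP ->; rewrite ?ie.
  by have := nonneighbors_le us sN nt; have := dN x xN; rewrite N5 /=; lia.
case: (boolP [forall x in N, forall y in N, (x != y) ==> e x y]) => [/forall_inP h|].
  by left=> x y xN yN xy; have /forall_inP /(_ y yN) /implyP := h x xN; apply.
case/forall_inPn => a aN /forall_inPn [a' a'N]; rewrite negb_imply => /andP [aa' naa'].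
right.
have : size (enum (N :\ a :\ a')) = 3.
  have := cardsD1 a N; have := cardsD1 a' (N :\ a).
  by rewrite -cardE !inE aN a'N eq_sym aa' N5 /=; lia.
have uE := enum_uniq (N :\ a :\ a').
have iE x : (x \in enum (N :\ a :\ a')) = [&& x != a', x != a & x \in N] by rewrite mem_enum !inE.
case: (enum _) uE iE => [|r1 [|r2 [|r3 []]]] // ur ir _.
have [r1a' r1a r1N] : [/\ r1 != a', r1 != a & r1 \in N] by apply/and3P; rewrite -ir !inE eqxx.
have [r2a' r2a r2N] : [/\ r2 != a', r2 != a & r2 \in N] by apply/and3P; rewrite -ir !inE eqxx orbT.
have [r3a' r3a r3N] : [/\ r3 != a', r3 != a & r3 \in N] by apply/and3P; rewrite -ir !inE eqxx !orbT.
move: ur; rewrite /= !inE negb_or andbT => /andP [/andP [r12 r13] r23].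
have ar r : r \in N -> r != a -> r != a' -> e a r.
  by move=> rN ra ra'; apply: (nn a a') => //=; rewrite !inE negb_or aa' !(eq_sym _ r) ra ra'.
have a'r r : r \in N -> r != a -> r != a' -> e a' r.
  by move=> rN ra ra'; apply: (nn a' a) => //=; rewrite ?inE ?negb_or 1?se // eq_sym aa' !(eq_sym _ r) ra ra'.
have fin q b b' : [:: r1; r2; r3] =i [:: q; b; b'] -> uniq [:: q; b; b'] -> e q b -> e q b' ->
   exists a a' q b b', [/\ uniq [:: a; a'; q; b; b'], N =i [:: a; a'; q; b; b'],
     ~~ e a a', [/\ e a q, e a b & e a b'] &
     [/\ e a' q, e a' b, e a' b', e q b & e q b']].
  move=> iq uq qb qb'; exists a, a', q, b, b'.
  have mq x : x \in [:: q; b; b'] -> [&& x != a', x != a & x \in N] by rewrite -iq ir.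
  have /and3P [q1 q2 q3] := mq q ltac:(by rewrite inE eqxx).
  have /and3P [b1 b2 b3] := mq b ltac:(by rewrite !inE eqxx orbT).
  have /and3P [c1 c2 c3] := mq b' ltac:(by rewrite !inE eqxx !orbT).
  split=> //; last 2 first.
  - by rewrite !ar.
  - by rewrite !a'r.
  - by move: uq; rewrite /= !inE !negb_or aa' !(eq_sym a) !(eq_sym a') q1 q2 b1 b2 c1 c2.
  - move=> x; rewrite 2!inE -iq ir.
    have [->|xa] := eqVneq x a; first by rewrite aN.
    by have [->|xa'] := eqVneq x a'; first by rewrite a'N.
(* At most one pair among the three remaining vertices is non-adjacent, so one of them is joined to
   the other two and serves as [q]. *)
have [e12|n12] := boolP (e r1 r2); last first.
  have e13 : e r1 r3 by apply: (nn r1 r2) => //=; rewrite !inE negb_or r12 r13 r23.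
  have e23 : e r2 r3 by apply: (nn r2 r1) => //=; rewrite ?inE ?negb_or 1?se // 1?eq_sym ?r12 ?r13 ?r23.
  apply: (fin r3 r1 r2); rewrite 1?(se r3 r1) 1?(se r3 r2) //; first by move=> x; rewrite !inE orbA orbC.
  by rewrite /= !inE negb_or !(eq_sym r3) r13 r23 r12.
have [e13|n13] := boolP (e r1 r3).
  by apply: (fin r1 r2 r3) => //; rewrite /= !inE negb_or r12 r13 r23.
have e23 : e r2 r3.
  by rewrite se; apply: (nn r3 r1) => //=; rewrite ?inE ?negb_or 1?se // !(eq_sym r3) r12 r13 r23.
apply: (fin r2 r1 r3); rewrite 1?(se r2 r1) //; first by move=> x; rewrite !inE orbCA.
by rewrite /= !inE negb_or r23 eq_sym r12 r13.
Qed.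

End FiveCliques.

(** * The edge bound for graphs without a [K_5] minor *)

Section FiveCliqueMinors.
Variable (T : finType).
Implicit Types (e : rel T) (u v x y : T) (A N W C : {set T}).

(** A decidable form of [hasK]: tuples of fixed length range over a finite type. *)
Definition hasKb k e W :=
  [exists s : k.-tuple {set T}, pairwise (separate_touching e) s &&
     all (fun A => [&& A != set0, A \subset W & [forall x in A, forall y in A,
            connect [rel u v | [&& e u v, u \in A & v \in A]] x y]]) s].

Lemma hasKP k e W : reflect (hasK k e W) (hasKb k e W).
Proof.
apply: (iffP existsP) => [[s /andP [pw /allP sP]]|[s [sz pw sP]]].
  exists s; split; rewrite ?size_tuple // => A /sP /and3P [A0 AW /forall_inP cA].
  by split=> // x y /cA /forall_inP; apply.
exists (Tuple (introT eqP sz)); rewrite pw; apply/allP => A /sP [A0 AW cA].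
by rewrite A0 AW; apply/forall_inP => x xA; apply/forall_inP => y yA; exact: cA.
Qed.

Lemma hasK5_attach e W A x1 x2 x3 x4 : symmetric e -> irreflexive e ->
  connected_in e A -> A != set0 -> A \subset W ->
  all (fun x => [&& x \in W, x \notin A & [exists y in A, e x y]]) [:: x1; x2; x3; x4] ->
  [&& e x1 x2, e x1 x3, e x1 x4, e x2 x3, e x2 x4 & e x3 x4] -> hasK 5 e W.
Proof.
move=> se ie cA A0 AW /allP xP E.
have xA x : x \in [:: x1; x2; x3; x4] -> separate_touching e [set x] A.
  by move=> /xP /and3P [_ xA tA]; rewrite separate_touching1 xA.
exists [:: [set x1]; [set x2]; [set x3]; [set x4]; A]; split=> //.
  rewrite /= !separate_touching11 // !xA ?inE ?eqxx ?orbT // !andbT.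
  by case/and5P: E => -> -> -> -> /andP [-> ->].
have xW x : x \in [:: x1; x2; x3; x4] ->
    [/\ [set x] != set0, [set x] \subset W & connected_in e [set x]].
  move=> /xP /and3P [xW _ _]; split; last exact: connected_in1.
    by apply/set0Pn; exists x; rewrite set11.
  by rewrite sub1set.
by move=> B; rewrite !inE => /or4P [/eqP->|/eqP->|/eqP->|/orP [/eqP->|/eqP-> //]];
  apply: xW; rewrite !inE eqxx ?orbT.
Qed.

(** A minimal counterexample has a vertex [u] of degree at most five whose neighbourhood has minimum
    degree at least three. Four neighbours form a clique, which [u] completes; five form a clique or
    contain a wheel. *)
Lemma K5_minor_free_bound e W : symmetric e -> irreflexive e -> 3 <= #|W| ->
  ~ hasK 5 e W -> esum e W + 12 <= 6 * #|W|.
Proof.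
(* Here [n0 = 3] and [d = 12]: the bound is [3 n - 6] edges, attained by a triangle. *)
apply: (extremal_induction (c := 3)) => // {}e {}W se ie W3 dW tW es _.
have [/exists_inP [u uW du]|/exists_inPn h] := boolP [exists u in W, #|nbs e W u| <= 5]; last first.
  have : 6 * #|W| <= esum e W by apply: esum_ge => x /h; rewrite -ltnNge.
  lia.
set N := nbs e W u.
have NW : N \subset W := nbs_sub e W u.
have NE x : x \in N -> nbs e N x = nbs e W u :&: nbs e W x.
  by move=> xN; apply/setP => y; rewrite !inE; case: (y \in W).
have dN x : x \in N -> 3 <= #|nbs e N x|.
  by move=> xN; rewrite NE //; move: xN; rewrite inE => /andP [xW ux]; apply: tW.
have uN x : x \in N -> e u x by rewrite inE => /andP [].
have /set0Pn [x xN] := dW u uW.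
have N4 := nbs_lt ie xN; have := dN x xN => d3.
have [N5|N5] := eqVneq #|N| 5; last first.
  have cN : {in N &, forall x y, x != y -> e x y}.
    move=> y z yN zN yz; apply: contraT => nyz.
    have sN : {subset [:: y; z] <= N} by apply/allP; rewrite /= yN zN.
    have nt : {in [:: y; z], forall t, ~~ e y t}.
      by move=> t; rewrite !inE => /orP [] /eqP ->; rewrite ?ie.
    have := nonneighbors_le _ sN nt; rewrite /= inE yz => /(_ isT).
    by have := dN y yN; move: N5 du; rewrite /N; lia.
  have <- : #|u |: N| = 5.
    by rewrite cardsU1 (nbs_irr _ _ ie); move: N5 du N4 d3; rewrite /N; lia.
  apply: hasK_clique => //; first by rewrite subUset sub1set uW.
  move=> y z; rewrite !in_setU1 => /orP [/eqP->|yN] /orP [/eqP->|zN]; first by rewrite eqxx.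
  - by move=> _; apply: uN.
  - by move=> _; rewrite se; apply: uN.
  - exact: cN.
have [cN|[a [a' [q [b [b' [us Ni naa' [aq ab ab'] [a'q a'b a'b' qb qb']]]]]]]] := clique_or_wheel se ie N5 dN.
  by rewrite -N5; apply: hasK_clique.
have mN t : t \in [:: a; a'; q; b; b'] -> (t \in W) && e u t by rewrite -Ni inE.
move: mN us => /allP; rewrite /= !inE !negb_or => /and5P [/andP [aW ua] /andP [a'W ua'] /andP [qW uq] /andP [bW ub]].
rewrite andbT => /andP [b'W ub'] /and4P [/and4P [aa'n aq' abn ab'n] /and3P [a'qn a'bn a'b'n] /andP [qbn qb'n] /andP [bb' _]].
have nu t : e u t -> u != t by apply: contraTneq => <-; rewrite ie.
(* The rim edge [a' b'] is contracted: [a] sees [b'], [b] sees [a'], and [u] and [q] see both. *)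
apply: (@hasK5_attach e W (a' |: [set b']) u q a b) => //.
- by apply: connected_inU => //; rewrite ?touches1; try exact: connected_in1; apply/exists_inP; exists b'; rewrite ?set11.
- by apply/set0Pn; exists a'; rewrite setU11.
- by rewrite subUset !sub1set a'W.
- rewrite /= uW qW aW bW !inE !negb_or !nu //= (eq_sym q a') a'qn qb'n.
  rewrite (eq_sym b) a'bn bb' ab'n aa'n !andbT /=; apply/and4P; split; apply/exists_inP.
  + by exists a'; rewrite ?setU11.
  + by exists a'; rewrite ?setU11 // se.
  + by exists b'; rewrite ?setU1r ?set11.
  + by exists a'; rewrite ?setU11 // se.
- by rewrite uq ua ub se aq qb ab.
Qed.

End FiveCliqueMinors.

(** * A [K_5] minor avoiding a vertex of a small dense graph *)

Section AvoidedVertex.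
Variables (T : finType) (e : rel T) (H : {set T}).
Hypotheses (se : symmetric e) (ie : irreflexive e).
Implicit Types (u v x y z : T) (C D : {set T}).

Definition nonuniversal v := [exists v' in H, (v != v') && ~~ e v v'].

Lemma nonuniversal_card v : v \in H -> nonuniversal v = (#|nbs e H v| + 2 <= #|H|).
Proof.
move=> vH; apply/exists_inP/idP => [[v' v'H /andP [vv' nvv']]|].
  have sN : {subset [:: v; v'] <= H} by apply/allP; rewrite /= vH v'H.
  have nt : {in [:: v; v'], forall t, ~~ e v t} by apply/allP; rewrite /= ie nvv'.
  by have := nonneighbors_le _ sN nt; rewrite /= inE vv' addnC; apply.
move=> lt; have : nbs e H v != H :\ v.
  apply: contraTneq lt => ->; have := cardsD1 v H; rewrite vH; lia.
have : nbs e H v \subset H :\ v.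
  by apply/subsetP => x; rewrite !inE => /andP [-> vx]; rewrite andbT; apply: contraTneq vx => ->; rewrite ie.
rewrite eqEsubset => -> /= /subsetPn [v']; rewrite !inE => /andP [v'v v'H].
by rewrite v'H /= => nvv'; exists v'; rewrite // eq_sym v'v.
Qed.

Hypotheses (H_ge : 6 <= #|H|) (H_le : #|H| <= 9).
Hypothesis (H_deg : forall x, x \in H -> 5 <= #|nbs e H x|).
Hypothesis no_K5 : forall v, v \in H -> nonuniversal v -> ~ hasK 5 e (H :\ v).

Lemma esum_le_nonuniversal v : v \in H -> nonuniversal v ->
  esum e H + 18 <= 6 * #|H| + #|nbs e H v|.*2.
Proof.
move=> vH nv; have := cardsD1 v H; rewrite vH => Hv.
have := K5_minor_free_bound se ie _ (no_K5 vH nv).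
by rewrite (esum_D1 se ie vH); lia.
Qed.

Hypothesis H_not_clique : exists2 v, v \in H & nonuniversal v.

(** A vertex of minimum degree [d] is non-universal since [H] is not a clique. Comparing [d * #|H|]
    with the edge bound for that vertex excludes [d = 6] and [d = 7]; putting [d = 5] gives the
    second claim. *)
Lemma exists_deg5 :
  (exists2 u, u \in H & #|nbs e H u| = 5) /\ esum e H + 8 <= 6 * #|H|.
Proof.
have [v0 v0H nv0] := H_not_clique.
have [v vH vmin] := arg_minnP (fun x => #|nbs e H x|) v0H.
have lt0 := nv0; rewrite nonuniversal_card // in lt0.
have := vmin v0 v0H => /= le0.
have nv : nonuniversal v by rewrite nonuniversal_card //; lia.
have := esum_le_nonuniversal vH nv; have := esum_ge vmin; have := H_deg vH.
move: le0 lt0; set d := #|nbs e H v| => le0 lt0 d5 dS SS.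
have d_eq : d = 5.
  have : [|| #|H| == 6, #|H| == 7, #|H| == 8 | #|H| == 9] by lia.
  by case/or4P => /eqP E; rewrite E in dS SS lt0; lia.
by split; [exists v | lia].
Qed.

(** The degrees exceed five by at most [#|H| - 8] in total, hence by at most one. *)
Lemma excess_le x y : x \in H -> y \in H -> x != y ->
  #|nbs e H x| + #|nbs e H y| <= 11.
Proof.
move=> xH yH xy; have [_ S] := exists_deg5.
have E : esum e H = \sum_(z in H) (#|nbs e H z| - 5) + 5 * #|H|.
  rewrite mulnC -sum_nat_const -big_split /=; apply: eq_bigr => z /H_deg; lia.
rewrite E (bigD1 x) //= (bigD1 y) ?yH 1?eq_sym //= in S.
by have := H_deg xH; have := H_deg yH; lia.
Qed.

(** The degree sum forces [#|H| >= 8] while all degrees are at most six, so every vertex is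
    non-universal. *)
Lemma no_K5_all v : v \in H -> ~ hasK 5 e (H :\ v).
Proof.
move=> vH; apply: no_K5 => //; rewrite nonuniversal_card //.
have [[u uH du] S] := exists_deg5; have S5 := esum_ge H_deg.
have [->|uv] := eqVneq v u; first by rewrite du; lia.
by have := excess_le vH uH uv; lia.
Qed.

Lemma exists_deg5_in D : D \subset H -> 2 <= #|D| -> exists2 c, c \in D & #|nbs e H c| = 5.
Proof.
move=> /subsetP DH /card_gt1P [x [y [xD yD xy]]].
have := excess_le (DH _ xD) (DH _ yD) xy.
have := H_deg (DH _ xD); have := H_deg (DH _ yD) => dy dx s.
have [dx5|dx5] := eqVneq #|nbs e H x| 5; first by exists x.
by exists y => //; lia.
Qed.

(** With fewer common neighbours, contracting [a b] in [H :\ v] would leave too many edges for the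
    [K_5] bound, as [#|H| <= 9]. *)
Lemma common_ge2 v a b : v \in H -> #|nbs e H v| = 5 -> a \in H :\ v -> b \in H :\ v ->
  e a b -> 2 <= #|nbs e (H :\ v) a :&: nbs e (H :\ v) b|.
Proof.
move=> vH dv aH bH ab.
have [e' [se' ie' nK E]] := contract_edge se ie aH bH ab (no_K5_all vH).
have Hv := cardsD1 v H; rewrite vH in Hv.
have Hb := cardsD1 b (H :\ v); rewrite bH in Hb.
have := K5_minor_free_bound se' ie' _ nK.
have := esum_ge H_deg; have := esum_D1 se ie vH; rewrite dv; lia.
Qed.

(** Removing a degree-five [v] off the edge leaves two common neighbours. One of them has degree
    five; removing it instead still leaves two, which makes three. *)
Lemma common_ge3 a b : a \in H -> b \in H -> e a b -> 3 <= #|nbs e H a :&: nbs e H b|.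
Proof.
move=> aH bH ab.
have sub c : nbs e (H :\ c) a :&: nbs e (H :\ c) b = (nbs e H a :&: nbs e H b) :\ c.
  by apply/setP => x; rewrite !inE; case: (x == c); rewrite ?andbF.
have inHc c x : x \in H -> x != c -> x \in H :\ c by rewrite !inE => -> ->.
have [||v + dv] := @exists_deg5_in (H :\ a :\ b).
- by rewrite !(subset_trans (subD1set _ _)).
- by have := cardsD1 a H; have := cardsD1 b (H :\ a); rewrite aH; lia.
rewrite !inE => /and3P [vb va vH].
have := common_ge2 vH dv (inHc _ _ aH _) (inHc _ _ bH _) ab.
rewrite sub !(eq_sym _ v) => /(_ va vb) c2.
have [||c cD dc] := @exists_deg5_in (nbs e H a :&: nbs e H b).
- by rewrite subIset // nbs_sub.
- by apply: leq_trans c2 _; apply: subset_leq_card; exact: subD1set.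
have := cD; rewrite !inE => /andP [/andP [cH ac] /andP [_ bc]].
have ca : a != c by apply: contraTneq ac => ->; rewrite ie.
have cb : b != c by apply: contraTneq bc => ->; rewrite ie.
have := common_ge2 cH dc (inHc _ _ aH ca) (inHc _ _ bH cb) ab.
by rewrite sub [in X in _ -> X](cardsD1 c) cD.
Qed.

Lemma no_K5_avoiding v A x1 x2 x3 x4 : v \in H ->
  connected_in e A -> A != set0 -> A \subset H -> v \notin A ->
  all (fun x => [&& x \in H, x != v, x \notin A & touches e [set x] A]) [:: x1; x2; x3; x4] ->
  [&& e x1 x2, e x1 x3, e x1 x4, e x2 x3, e x2 x4 & e x3 x4] -> False.
Proof.
move=> vH cA A0 AH vA xP xE; case: (no_K5_all vH).
apply: (hasK5_attach (A := A)) xE => //.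
  by apply/subsetP => x xA; rewrite !inE (subsetP AH) // andbT; apply: contraNneq vA => <-.
by apply: sub_all xP => x /and4P [xH xv xA]; rewrite touches1 !inE xv xH xA.
Qed.

(** The neighbourhood [N] of a degree-five [u] is a clique or a wheel with hub [q]. In a wheel,
    joining opposite rim vertices through the non-neighbours of [u] gives a [K_5] minor missing a
    vertex; if no such connection exists, some degree drops below five. *)
Lemma avoiding_contradiction : False.
Proof.
have [[u uH du] _] := exists_deg5; set N := nbs e H u in du.
have NE x : x \in N -> nbs e N x = nbs e H u :&: nbs e H x.
  by move=> xN; apply/setP => y; rewrite !inE; case: (y \in H).
have NH x : x \in N -> (x \in H) && e u x by rewrite inE.
have dN x : x \in N -> 3 <= #|nbs e N x|.
  by move=> xN; have /andP [xH ux] := NH x xN; rewrite NE // common_ge3.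
have [cN|[a [a' [q [b [b' [us Ni naa' [aq ab ab'] [a'q a'b a'b' qb qb']]]]]]]] :=
  clique_or_wheel se ie du dN.
  apply: (no_K5_all uH); rewrite -du; apply: hasK_clique => //.
  apply/subsetP => x xN; have /andP [xH ux] := NH x xN.
  by rewrite !inE xH andbT; apply: contraTneq ux => ->; rewrite ie.
have mN t : t \in [:: a; a'; q; b; b'] -> (t \in H) && e u t by rewrite -Ni => /NH.
have /allP := mN; rewrite /= andbT => /and5P [/andP [aH ua] /andP [a'H ua'] /andP [qH uq] /andP [bH ub] /andP [b'H ub']].
have nE x y : e x y -> x != y by apply: contraTneq => ->; rewrite ie.
have sE x y : e x y -> e y x by rewrite se.
have [aa' bb'] : a != a' /\ b != b'.
  by move: us; rewrite /= !inE !negb_or => /and4P [/and4P [-> _ _ _] _ _ /andP [-> _]].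
have t11 x y : touches e [set x] [set y] = e x y.
  by rewrite touches1; apply/exists_inP/idP => [[_ /set1P ->] //|xy]; exists y; rewrite ?set11.
have q'E : [/\ e q a, e q a', e q b & e q b'] by split=> //; exact: sE.
have [qa qa' _ _] := q'E.
(* A chord [b b'] would make [u], [q], [b], [b'], [a] a clique missing [a']. *)
have nbb' : ~~ e b b'.
  apply/negP => ebb'; apply: (@no_K5_avoiding a' [set a] u q b b') => //.
  - exact: connected_in1.
  - by apply/set0Pn; exists a; rewrite set11.
  - by rewrite sub1set.
  - by rewrite inE eq_sym.
  - rewrite /= !inE !t11 uH qH bH b'H ua qa !(sE _ _ ab, sE _ _ ab').
    by rewrite !(nE _ _ ua, nE _ _ ua', nE _ _ qa, nE _ _ qa', nE _ _ (sE _ _ ab), nE _ _ (sE _ _ ab'), nE _ _ (sE _ _ a'b), nE _ _ (sE _ _ a'b')).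
  - by rewrite uq ub ub' qb qb' ebb'.
pose Z := H :\: (u |: N).
have ZP z : z \in Z -> [/\ z \in H, z != u, ~~ e u z & z \notin [:: a; a'; q; b; b']].
  rewrite -Ni !inE negb_or => /andP [/andP [-> ]]; rewrite negb_and => + zH.
  by rewrite zH.
(* Absorbing [C] into [x] makes it adjacent to the opposite [x']; with [u], [q] and [y] this is a
   [K_5] minor missing [y']. *)
have detour x x' y y' C :
    [&& x \in N, x' \in N, y \in N & y' \in N] ->
    [&& e x y, e x q, e x' y, e x' q & e y q] -> x != x' ->
    [&& y' != x, y' != x', y' != y & y' != q] ->
    C \subset Z -> connected_in e C -> touches e [set x] C -> touches e [set x'] C -> False.
  move=> /and4P [xN x'N yN y'N] /and5P [xy xq x'y x'q yq] xx' /and4P [y'x y'x' y'y y'q] CZ cC tx tx'.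
  have [/andP [xH ux] /andP [x'H ux'] /andP [yH uy] /andP [y'H uy']] := And4 (NH _ xN) (NH _ x'N) (NH _ yN) (NH _ y'N).
  have notC t : (t == u) || (t \in N) -> t \notin C.
    by move=> tN; apply/negP => /(subsetP CZ); rewrite !inE -in_nbs -/N tN.
  apply: (@no_K5_avoiding y' (x |: C) u q y x') => //.
  - by apply: connected_inU => //; exact: connected_in1.
  - by apply/set0Pn; exists x; rewrite setU11.
  - rewrite subUset sub1set xH; apply: subset_trans CZ _; exact: subsetDl.
  - by rewrite !inE negb_or y'x notC // y'N orbT.
  - have tU t : e t x -> touches e [set t] (x |: C).
      by move=> tx0; rewrite touches1; apply/exists_inP; exists x; rewrite ?setU11.
    have tC : touches e [set x'] (x |: C).
      move: tx'; rewrite !touches1 => /exists_inP [t tC xt]; apply/exists_inP; exists t => //.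
      by rewrite setU1r.
    have qN : q \in N by rewrite Ni !inE eqxx !orbT.
    rewrite /= uH qH yH x'H tC (tU u) ?(tU q (sE _ _ xq)) ?(tU y (sE _ _ xy)) //.
    rewrite !inE !negb_or !notC ?eqxx ?qN ?yN ?x'N ?orbT //.
    by rewrite (nE _ _ uy') (nE _ _ ux) !(eq_sym _ y') y'q y'y y'x' (eq_sym x') xx'
      (nE _ _ (sE _ _ xq)) (nE _ _ (sE _ _ xy)).
  - by rewrite uq uy ux' !(sE _ _ yq, sE _ _ x'q, sE _ _ x'y).
have memN t : t \in [:: a; a'; q; b; b'] -> t \in N by rewrite Ni.
have [aN a'N bN b'N] : [/\ a \in N, a' \in N, b \in N & b' \in N].
  by split; apply: memN; rewrite !inE eqxx ?orbT.
have dist := us; move: dist; rewrite /= !inE !negb_or => /and4P [/and4P [_ naq nab nab'] /and3P [na'q na'b na'b'] /andP [nqb nqb'] _].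
have uN : u \notin N by exact: nbs_irr.
have cZ : #|Z| + 6 = #|H|.
  have uNH : u |: N \subset H by rewrite subUset sub1set uH; exact: nbs_sub.
  by rewrite -(cardsID (u |: N) H) (setIidPr uNH) cardsU1 uN du addnC.
have ZnN z : z \in Z -> (z != u) && (z \notin N) by rewrite !inE -in_nbs -/N negb_or => /andP [].
have NnZ x : x \in N -> x \notin Z by apply: contraL => /ZnN /andP [].
have ZH z : z \in Z -> z \in H by apply/subsetP; exact: subsetDl.
(* Otherwise [x] misses itself, [x'] and all of [Z], so its degree is at most
   [#|H| - #|Z| - 2 = 4]. *)
have exit x x' : x \in N -> x' \in N -> x != x' -> ~~ e x x' -> exists2 z, z \in Z & e x z.
  move=> xN x'N xx' nxx'; apply/exists_inP/contraT => /exists_inPn nz.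
  have [/andP [xH _] /andP [x'H _]] := conj (NH _ xN) (NH _ x'N).
  have us' : uniq [:: x, x' & enum Z].
    by rewrite /= !inE !mem_enum !negb_or xx' !NnZ // enum_uniq.
  have sN : {subset [:: x, x' & enum Z] <= H}.
    by move=> t; rewrite !in_cons mem_enum => /or3P [/eqP->|/eqP->|/ZH].
  have nt : {in [:: x, x' & enum Z], forall t, ~~ e x t}.
    by move=> t; rewrite !in_cons mem_enum => /or3P [/eqP->|/eqP->|/nz]; rewrite ?ie.
  have := nonneighbors_le us' sN nt; rewrite -cZ /= -cardE !addSn -!addnS leq_add2l.
  by move=> le; have := leq_trans (H_deg xH) le.
have [z zZ az] := exit a a' aN a'N aa' naa'.
have a'a : ~~ e a' a by rewrite se.
have [z' z'Z a'z'] := exit a' a a'N aN ltac:(by rewrite eq_sym) a'a.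
have detour_a C : C \subset Z -> connected_in e C -> touches e [set a] C -> touches e [set a'] C -> False.
  apply: (detour a a' b b'); rewrite ?aN ?a'N ?bN ?b'N ?ab ?aq ?a'b ?a'q ?(sE _ _ qb) //.
  by rewrite !(eq_sym b') nab' na'b' bb' nqb'.
have detour_b C : C \subset Z -> connected_in e C -> touches e [set b] C -> touches e [set b'] C -> False.
  apply: (detour b b' a a'); rewrite ?aN ?a'N ?bN ?b'N ?(sE _ _ ab) ?(sE _ _ ab') ?aq ?(sE _ _ qb) ?(sE _ _ qb') //.
  by rewrite na'b na'b' (eq_sym a') aa' na'q.
have one C t x x' : t \in Z -> e x t -> e x' t ->
   (C \subset Z -> connected_in e C -> touches e [set x] C -> touches e [set x'] C -> False) -> C = [set t] -> False.
  move=> tZ xt x't CP CE; subst C; apply: CP; rewrite ?sub1set ?t11 //; exact: connected_in1.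
have [zz'|zz'] := eqVneq z z'.
  by apply: (one _ z a a' zZ az _ (detour_a _) erefl); rewrite zz'.
have [ezz'|nzz'] := boolP (e z z').
  apply: (detour_a [set z; z']).
  - by rewrite subUset !sub1set zZ z'Z.
  - by apply: connected_inU => //; rewrite ?t11 //; exact: connected_in1.
  - by rewrite touches1; apply/exists_inP; exists z; rewrite ?set21.
  - by rewrite touches1; apply/exists_inP; exists z'; rewrite ?set22.
(* As [[set z]] is no detour, [z] misses one of [a], [a'] and one of [b], [b']. It also misses
   itself, [u] and [z']: five of at most nine vertices, against degree five. *)
have [x [xa nzx]] : exists x, x \in [:: a; a'] /\ ~~ e z x.
  have [eza'|] := boolP (e z a'); last by exists a'; rewrite !inE eqxx orbT.
  by case: (one _ z a a' zZ az (sE _ _ eza') (detour_a _) erefl).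
have [y [yb nzy]] : exists y, y \in [:: b; b'] /\ ~~ e z y.
  have [ezb|] := boolP (e z b); last by exists b; rewrite !inE eqxx.
  have [ezb'|] := boolP (e z b'); last by exists b'; rewrite !inE eqxx orbT.
  by case: (one _ z b b' zZ (sE _ _ ezb) (sE _ _ ezb') (detour_b _) erefl).
have xN : x \in N by move: xa; rewrite !in_cons orbF => /orP [] /eqP ->.
have yN : y \in N by move: yb; rewrite !in_cons orbF => /orP [] /eqP ->.
have xy : x != y by move: xa yb; rewrite !in_cons !orbF => /orP [] /eqP -> /orP [] /eqP ->.
have [zu zN] := andP (ZnN _ zZ); have [z'u z'N] := andP (ZnN _ z'Z).
have [zH _ nuz _] := ZP _ zZ.
have nN t w : t \in N -> w \notin N -> (t != w) && (w != t).
  by move=> tN; rewrite (eq_sym w) andbb; apply: contraNneq => <-.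
have us5 : uniq [:: z; u; z'; x; y].
  rewrite /= !inE !negb_or zu zz' (eq_sym u z') z'u xy.
  by have [/andP[_ ->] /andP [_ ->]] := conj (nN _ _ xN zN) (nN _ _ yN zN);
     have [/andP[_ ->] /andP [_ ->]] := conj (nN _ _ xN z'N) (nN _ _ yN z'N);
     have [/andP[_ ->] /andP [_ ->]] := conj (nN _ _ xN uN) (nN _ _ yN uN).
have sH5 : {subset [:: z; u; z'; x; y] <= H}.
  apply/allP; rewrite /= zH uH (ZH _ z'Z).
  by have [/andP [-> _] /andP [-> _]] := conj (NH _ xN) (NH _ yN).
have nt5 : {in [:: z; u; z'; x; y], forall t, ~~ e z t}.
  by apply/allP; rewrite /= ie (se z u) nuz nzz' nzx nzy.
have := leq_trans (nonneighbors_le us5 sH5 nt5) H_le; rewrite leqNgt => /negP; apply.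
exact: (leq_add (leqnn 5) (H_deg zH)).
Qed.

End AvoidedVertex.

(** If both alternatives fail, the preceding contradiction applies; [hasKb] makes the case
    distinction decidable. *)
Lemma five_clique_minor_avoiding (T : finType) (e : rel T) (H : {set T}) :
  symmetric e -> irreflexive e -> 6 <= #|H| -> #|H| <= 9 ->
  (forall x, x \in H -> 5 <= #|nbs e H x|) ->
  {in H &, forall x y, x != y -> e x y} \/
  exists2 v, v \in H & nonuniversal e H v /\ hasK 5 e (H :\ v).
Proof.
move=> se ie h6 h9 dH.
have [/exists_inP [v vH /andP [nv /hasKP kv]]|no] :=
  boolP [exists v in H, nonuniversal e H v && hasKb 5 e (H :\ v)].
  by right; exists v.
have [/exists_inP [v vH nv]|uH] := boolP [exists v in H, nonuniversal e H v].
  case: (@avoiding_contradiction T e H se ie h6 h9 dH) => [w wH nw /hasKP kw|].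
    by case/exists_inP: no; exists w; rewrite // nw.
  by exists v.
left=> x y xH yH xy; apply: contraNT uH => nxy.
by apply/exists_inP; exists x => //; apply/exists_inP; exists y; rewrite // xy.
Qed.

(** * Reachability and the separator count *)

Lemma connected_in_reach (T : finType) (e : rel T) (Y Z : {set T}) : symmetric e ->
  Y \subset Z -> connected_in e Y ->
  connected_in e [set z in Z | [exists y in Y,
    connect [rel a b | [&& e a b, a \in Z & b \in Z]] y z]].
Proof.
move=> se YZ cY; set r := [rel a b | _]; set K := [set z in Z | _].
have YK : Y \subset K.
  by apply/subsetP => y yY; rewrite inE (subsetP YZ) //; apply/exists_inP; exists y.
(* A path of [Z] starting in [K] stays in [K], so points of [K] are joined through [Y]. *)
have inK a b : a \in K -> connect r a b ->
    connect [rel u v | [&& e u v, u \in K & v \in K]] a b.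
  move=> aK /connectP [p pp ->]; elim: p a aK pp => [|c p IH] a aK /=; first by rewrite connect0.
  move=> /andP [/and3P [ac aZ cZ] pp].
  have cK : c \in K.
    rewrite inE cZ; move: aK; rewrite inE => /andP [_ /exists_inP [y yY ya]].
    by apply/exists_inP; exists y => //; apply: connect_trans ya (connect1 _); rewrite /r /= ac aZ.
  by apply: connect_trans (IH c cK pp); apply: connect1; rewrite /= ac aK.
have sym := connect_rel_sym K se.
move=> a b; rewrite !inE => /andP [_ /exists_inP [y yY ya]] /andP [_ /exists_inP [y' y'Y y'b]].
apply: connect_trans (inK _ _ (subsetP YK _ y'Y) y'b).
rewrite sym; apply: connect_trans (inK _ _ (subsetP YK _ yY) ya).
exact: connected_in_sub YK (cY _ _ y'Y yY).
Qed.

Lemma connect_exit (T : finType) (r : rel T) (X : {set T}) x y :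
  connect r x y -> x \in X -> y \notin X ->
  exists a b, [/\ connect r x a, r a b, a \in X & b \notin X].
Proof.
move=> /connectP [p pp ->]; elim: p x pp => [|c p IH] x /=; first by move=> _ ->.
move=> /andP [xc pp] xX lX; have [cX|cX] := boolP (c \in X); last by exists x, c.
have [a [b [ca ab aX bX]]] := IH c pp cX lX.
by exists a, b; split=> //; apply: connect_trans (connect1 xc) ca.
Qed.

(** For [n] inner and [s] boundary vertices, [Q] and [P] are their degree sums in the closure, [E]
    and [d] the degree sum and minimum degree inside the boundary, [m] the number of added edges.
    The premises give [P + 28 <= 8 s + 2 d]. For [d <= 5] this leaves only [d = 5], [s = 9], where
    [E = 45] is odd; for larger [d], [P >= 7 s] is too big. *)
Lemma separator_count P Q E s m n d : Q + P + m.*2 + 30 <= 10 * (n + s) -> 10 * n <= Q ->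
  ~~ odd E -> maxn 6 d.+1 * s <= P -> E + s <= P -> d * s <= E -> m + d + 1 = s -> s <= 9 ->
  False.
Proof.
move=> B X10 S_even degsum inner dsum cM S9.
have {B X10} B : P + m.*2 + 30 <= 10 * s by lia.
have [d5|d5] := leqP d 5.
  have max6 : maxn 6 d.+1 = 6 by lia.
  rewrite max6 in degsum.
  have [d_eq s_eq] : d = 5 /\ s = 9 by lia.
  have E45 : E = 45 by subst d s; lia.
  by rewrite E45 in S_even.
have max6 : maxn 6 d.+1 = d.+1 by lia.
have : s \in [:: 0; 1; 2; 3; 4; 5; 6; 7; 8; 9] by rewrite !inE; lia.
rewrite max6 in degsum; rewrite !inE.
have : 7 * s <= P by apply: leq_trans degsum; rewrite leq_mul2r; lia.
lia.
Qed.

Lemma hasK_le (T : finType) k j (e : rel T) W : j <= k -> hasK k e W -> hasK j e W.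
Proof.
move=> jk [s [sz pw sP]]; exists (take j s); split.
- by rewrite size_takel ?sz.
- exact: subseq_pairwise (take_subseq _ _) pw.
- by move=> A /mem_take; apply: sP.
Qed.

(** * Small separators in a graph whose edges lie in five triangles *)

Section Core.
Variables (T : finType) (e : rel T) (V : {set T}).
Hypotheses (se : symmetric e) (ie : irreflexive e).
Implicit Types (x y v w : T) (X Y S : {set T}).

Definition boundary X := [set y in V :\: X | [exists x in X, e x y]].

(** [Y] is the connected set to be contracted into a boundary vertex. It may be empty when the
    boundary is, so the descent can start from [V]. *)
Definition anchored X := exists Y : {set T},
  [/\ Y \subset V, connected_in e Y, [disjoint Y & X :|: boundary X] &
      forall s, s \in boundary X -> touches e [set s] Y].

Lemma in_boundary X y x : y \in V -> y \notin X -> x \in X -> e x y -> y \in boundary X.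
Proof. by move=> yV yX xX xy; rewrite !inE yV yX; apply/exists_inP; exists x. Qed.

Lemma boundaryP X y : y \in boundary X -> [/\ y \in V, y \notin X & exists2 x, x \in X & e x y].
Proof. by rewrite !inE => /andP [/andP [yX yV] /exists_inP]. Qed.

Lemma nbs_in_closure X x : x \in X -> nbs e V x \subset X :|: boundary X.
Proof.
move=> xX; apply/subsetP => y; rewrite in_nbs in_setU => /andP [yV xy].
by have [//|yX] := boolP (y \in X); rewrite (in_boundary yV yX xX xy).
Qed.

Lemma closure_sub X : X \subset V -> X :|: boundary X \subset V.
Proof. by move=> XV; rewrite subUset XV; apply/subsetP => y /boundaryP []. Qed.

Lemma nbs_closure X x : X \subset V -> x \in X -> nbs e (X :|: boundary X) x = nbs e V x.
Proof.
move=> XV xX; apply/setP => y; have /subsetP /(_ y) := nbs_in_closure xX.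
rewrite !in_nbs; case xy: (e x y); rewrite ?andbF // !andbT => h; apply/idP/idP => //.
by apply/subsetP; exact: closure_sub.
Qed.

Hypothesis common_ge5 :
  {in V &, forall x y, e x y -> 5 <= #|nbs e V x :&: nbs e V y|}.
Hypothesis esum_lt : esum e V < 10 * #|V|.
Hypothesis bound : forall (e' : rel T) (W : {set T}), symmetric e' -> irreflexive e' -> 5 <= #|W| -> #|W| < #|V| ->
  ~ hasK 7 e' W -> esum e' W + 30 <= 10 * #|W|.
Hypothesis no_K7 : ~ hasK 7 e V.

(** A neighbour [x] of [v] in [X] shares five neighbours with [v], all in the closure, and [x]
    itself lies off the boundary. *)
Lemma boundary_deg X v : X \subset V -> v \in boundary X ->
  6 <= #|nbs e (X :|: boundary X) v| /\ #|nbs e (boundary X) v| < #|nbs e (X :|: boundary X) v|.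
Proof.
move=> XV vS; have [vV vX [x xX xv]] := boundaryP vS.
have xV := subsetP XV x xX.
have xN : x \in nbs e (X :|: boundary X) v by rewrite in_nbs in_setU xX se.
split.
  rewrite (cardsD1 x) xN; apply: leq_trans (common_ge5 xV vV xv) _.
  apply: subset_leq_card; apply/subsetP => y; rewrite in_setI => /andP [yx yv].
  have yW := subsetP (nbs_in_closure xX) _ yx.
  move: yx yv; rewrite in_setD1 !in_nbs yW => /andP [_ xy] /andP [_ ->].
  by rewrite /= andbT; apply: contraTneq xy => ->; rewrite ie.
apply: proper_card; apply/properP; split.
  by apply/subsetP => y; rewrite !in_nbs in_setU => /andP [-> ->]; rewrite orbT.
by exists x; rewrite // in_nbs; apply: contraL xX => /andP [/boundaryP []].
Qed.

(** If all degrees in [X] were at least ten, contracting the anchor into a boundary vertex would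
    give a graph on the closure with too many edges. *)
Lemma low_degree_vertex X : X \subset V -> X != set0 -> #|boundary X| <= 9 -> anchored X ->
  exists2 w, w \in X & #|nbs e V w| <= 9.
Proof.
move=> XV /set0Pn [x0 x0X] S9 [Y [YV cY dY tY]]; set S := boundary X in S9 dY tY.
apply/exists_inP/contraT => /exists_inPn hi.
have {}hi x : x \in X -> 10 <= #|nbs e V x| by move=> /hi; rewrite -ltnNge.
pose W := X :|: S; have WV : W \subset V := closure_sub XV.
have W5 : 5 <= #|W|.
  apply: leq_trans (_ : 10 <= _) => //; apply: leq_trans (hi x0 x0X) _.
  by apply: subset_leq_card; exact: nbs_in_closure.
have dXS : [disjoint X & S].
  by rewrite disjoint_sym disjoint_subset; apply/subsetP => y /boundaryP [].
have cW : #|W| = #|X| + #|S| by rewrite -cardsUI (disjoint_setI0 dXS) cards0 addn0.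
have EW : esum e W = \sum_(x in X) #|nbs e V x| + \sum_(v in S) #|nbs e W v|.
  rewrite /esum (eq_bigl [in [predU X & S]]); last by move=> x; rewrite in_setU.
  rewrite bigU //; congr (_ + _); apply: eq_bigr => x xX.
  by rewrite nbs_closure.
have X10 : 10 * #|X| <= \sum_(x in X) #|nbs e V x|.
  by rewrite mulnC -sum_nat_const; apply: leq_sum => x /hi.
have nK (W' : {set T}) : W' \subset V -> ~ hasK 7 e W'.
  by move=> W'V hK; apply: no_K7; apply: (hasK_sub hK W'V).
(* With empty boundary, [X = V] contradicts [esum_lt] and a proper part contradicts [bound]. *)
have [S0|[s0 s0S]] := set_0Vmem S.
  have WX : W = X by rewrite /W S0 setU0.
  move: EW; rewrite S0 big_set0 addn0 WX => EX.
  have [XeV|XnV] := eqVneq X V; first by by move: esum_lt X10; rewrite -EX XeV; lia.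
  have ltX : #|X| < #|V| by apply: proper_card; rewrite properEneq XnV.
  rewrite WX in W5.
  by have := bound se ie W5 ltX (nK _ XV); move: X10; rewrite EX; lia.
have [v0 v0S vmin] : exists2 v0, v0 \in S & forall v, v \in S -> #|nbs e S v0| <= #|nbs e S v|.
  by case: (arg_minnP (fun x => #|nbs e S x|) s0S) => v0 v0S vmin; exists v0.
set d := #|nbs e S v0| in vmin.
(* The new neighbours of [v0] after contracting [Y]; the least degree of [v0] inside [S] makes them
   as many as possible. *)
pose M := (S :\ v0) :\: nbs e S v0.
have cM : #|M| + d + 1 = #|S|.
  have sub : nbs e S v0 \subset S :\ v0.
    by apply/subsetP => y; rewrite !inE => /andP [-> vy]; rewrite andbT; apply: contraTneq vy => ->; rewrite ie.
  by rewrite (cardsD1 v0 S) v0S -(cardsID (nbs e S v0) (S :\ v0)) (setIidPr sub) addn1 add1n addnC.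
have MW : M \subset W by apply/subsetP => y; rewrite !inE => /andP [_ /andP [_ ->]]; rewrite orbT.
have v0M : v0 \notin M by rewrite !inE eqxx andbF.
have dM : [disjoint M & nbs e W v0].
  rewrite disjoint_subset; apply/subsetP => y; rewrite !inE => /andP [nv /andP [_ yS]].
  by move: nv; rewrite yS /= => /negPf ->; rewrite andbF.
have v0W : v0 \in W by rewrite in_setU v0S orbT.
have ltW : #|W| < #|V|.
  have /touchesP [_ [y [_ yY _]]] := tY v0 v0S.
  apply: proper_card; apply/properP; split=> //; exists y; first exact: (subsetP YV).
  by rewrite (disjointFr dY yY).
have nK' : ~ hasK 7 (addstar e v0 M) W.
  apply: contra_not no_K7; apply: (hasK_contract (Y := Y)) => //.
  - exact: tY.
  - by rewrite disjoint_sym.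
  - by move=> x xM; apply: tY; move: xM; rewrite !inE => /andP [_ /andP [_]].
  - by rewrite subUset WV.
have {nK'} := bound (addstar_sym v0 M se) (addstar_irr ie v0M) W5 ltW nK'.
rewrite esum_addstar // EW cW => B.
have deg v : v \in S -> maxn 6 d.+1 <= #|nbs e W v|.
  move=> vS; have [d6 dlt] := boundary_deg XV vS.
  by rewrite geq_max d6 (leq_ltn_trans (vmin v vS)).
have degsum : maxn 6 d.+1 * #|S| <= \sum_(v in S) #|nbs e W v|.
  by rewrite mulnC -sum_nat_const; apply: leq_sum.
have inner : esum e S + #|S| <= \sum_(v in S) #|nbs e W v|.
  rewrite -sum1_card -big_split /=; apply: leq_sum => v vS; rewrite addn1.
  by have [_] := boundary_deg XV vS.
have dsum : d * #|S| <= esum e S := esum_ge vmin.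
have S_even := esum_even S se ie.
by case: (separator_count B X10 S_even degsum inner dsum cM S9).
Qed.

(** Were the closure different, a smaller anchored set would have its boundary inside [nbs e V w]:
    either a component of the non-neighbours of [w], anchored by [w], or the set [X'] below,
    anchored by [K]. *)
Lemma smallest_closure X w : X \subset V -> anchored X -> w \in X -> #|nbs e V w| <= 9 ->
  (forall X', X' \subset V -> X' != set0 -> #|boundary X'| <= 9 -> anchored X' ->
     #|X'| < #|X| -> False) ->
  X :|: boundary X = w |: nbs e V w.
Proof.
move=> XV [Y [YV cY dY tY]] wX w9 IH; set S := boundary X in dY tY *.
have wV := subsetP XV w wX.
have Nw := nbs_in_closure wX; rewrite -/S in Nw.
pose Z := V :\: (w |: nbs e V w).
pose r := [rel a b | [&& e a b, a \in Z & b \in Z]].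
have inZ x : x \in V -> (x \in Z) = (x != w) && ~~ e w x.
  by move=> xV; rewrite !inE xV andbT negb_or.
have ZV x : x \in Z -> x \in V by rewrite inE => /andP [].
have YZ : Y \subset Z.
  apply/subsetP => y yY; have := disjointFr dY yY; rewrite in_setU => /negbT.
  rewrite negb_or => /andP [yX yS]; rewrite inZ ?(subsetP YV) //.
  apply/andP; split; first by apply: contraNneq yX => ->.
  by apply: contra yS => wy; apply: in_boundary wX wy; rewrite ?(subsetP YV).
(* The enlarged anchor: all that [Y] reaches without meeting [w] or its neighbours. *)
pose K := [set z in Z | [exists y in Y, connect r y z]].
have inK z : (z \in K) = (z \in Z) && [exists y in Y, connect r y z] by rewrite inE.
have cK : connected_in e K by exact: connected_in_reach.
have YK : Y \subset K.
  by apply/subsetP => y yY; rewrite inK (subsetP YZ) //; apply/exists_inP; exists y.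
have KZ : K \subset Z by apply/subsetP => z; rewrite inK => /andP [].
have S_touches_K s : s \in S -> touches e [set s] K.
  move=> /tY; rewrite !touches1 => /exists_inP [y yY sy].
  by apply/exists_inP; exists y => //; exact: (subsetP YK).
have K_closed a b : a \in K -> b \in Z -> e a b -> b \in K.
  rewrite !inK => /andP [aZ /exists_inP [y yY ya]] bZ ab; rewrite bZ.
  apply/exists_inP; exists y => //; apply: connect_trans ya (connect1 _).
  by rewrite /= ab aZ.
have S_Z_K s : s \in S -> s \in Z -> s \in K.
  move=> sS sZ; have := tY s sS; rewrite touches1 => /exists_inP [y yY sy].
  by apply: (K_closed y) => //; [exact: (subsetP YK) | rewrite se].
(* The component [D] of [x] in [Z] either stays in [X], against minimality, or leaves it through a
   boundary vertex, which lies in [K]. *)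
have X_Z_K x : x \in X -> x \in Z -> x \in K.
  move=> xX xZ; pose D := [set z in Z | [exists y in [set x], connect r y z]].
  have cD : connected_in e D.
    by apply: connected_in_reach; rewrite ?sub1set //; exact: connected_in1.
  have inD z : (z \in D) = (z \in Z) && connect r x z.
    rewrite inE; congr (_ && _); apply/exists_inP/idP => [[_ /set1P ->] //|xz].
    by exists x; rewrite ?set11.
  have [DX|] := boolP (D \subset X).
    have bD s : s \in boundary D -> s \in nbs e V w.
      move=> /boundaryP [sV sD [z zD zs]]; rewrite in_nbs sV; apply: contraNT sD => nws.
      move: zD; rewrite !inD => /andP [zZ xz].
      have sw : s != w.
        by apply: contraTneq zs => ->; move: (zZ); rewrite inZ ?ZV // se => /andP [].
      have sZ : s \in Z by rewrite inZ ?sw.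
      by rewrite sZ (connect_trans xz) // connect1 //= zs zZ.
    exfalso; apply: (IH D).
    - exact: subset_trans DX XV.
    - by apply/set0Pn; exists x; rewrite inD xZ connect0.
    - by apply: leq_trans w9; apply: subset_leq_card; apply/subsetP.
    - exists [set w]; split.
      + by rewrite sub1set.
      + exact: connected_in1.
      + rewrite disjoints1 in_setU negb_or inD inZ ?eqxx //=.
        by apply: contraNN (nbs_irr V w ie) => /bD.
      + by move=> s /bD; rewrite touches1 in_nbs => /andP [_ ws]; apply/exists_inP; exists w; rewrite ?set11 // se.
    - apply: proper_card; apply/properP; split=> //; exists w => //.
      by rewrite inD inZ ?eqxx.
  move=> /subsetPn [z]; rewrite inD => /andP [zZ xz] zX.
  have [a [b [xa /and3P [ab aZ bZ] aX bX]]] := connect_exit xz xX zX.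
  have bK : b \in K by apply: (S_Z_K b _ bZ); exact: (in_boundary (ZV b bZ) bX aX ab).
  have aK : a \in K by apply: (K_closed b) => //; rewrite se.
  move: aK; rewrite inK => /andP [_ /exists_inP [y yY ya]].
  rewrite inK xZ; apply/exists_inP; exists y => //; apply: connect_trans ya _.
  by rewrite (connect_rel_sym Z se).
pose X' := [set x in X | (x == w) || e w x && ~~ touches e [set x] K].
have wX' : w \in X' by rewrite inE wX eqxx.
have X'X : X' \subset X by apply/subsetP => x; rewrite inE => /andP [].
have X'K x s : x \in X' -> s \in K -> e x s -> False.
  rewrite inE => /andP [xX /orP [/eqP ->|/andP [_ nt]]] sK xs.
    by have sZ := subsetP KZ _ sK; move: (sZ); rewrite inZ ?ZV // xs andbF.
  by case/negP: nt; rewrite touches1; apply/exists_inP; exists s.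
(* The boundary of [X'] consists of neighbours of [w] touching [K], so minimality forces
   [X' = X]. *)
have [X'eq|X'ne] := eqVneq X' X; last first.
  have bX' s : s \in boundary X' -> (s \in nbs e V w) && touches e [set s] K.
    move=> /boundaryP [sV sX' [x xX' xs]].
    have sw : s != w by apply: contraNneq sX' => ->.
    have xX := subsetP X'X _ xX'.
    have sW : (s \in X) || (s \in S).
      by have [//|nsX] := boolP (s \in X); apply: in_boundary xs.
    have ws : e w s.
      apply: contraT => nws; have sZ : s \in Z by rewrite inZ ?sw.
      have sK : s \in K by case/orP: sW => ?; [exact: X_Z_K | exact: S_Z_K].
      by case: (X'K x s).
    rewrite in_nbs sV ws /=; have [/S_touches_K //|nS] := boolP (s \in S).
    move: sW; rewrite (negPf nS) orbF => sX.
    by apply: contraNT sX' => nt; rewrite inE sX ws nt orbT.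
  exfalso; apply: (IH X').
  - exact: subset_trans X'X XV.
  - by apply/set0Pn; exists w.
  - by apply: leq_trans w9; apply: subset_leq_card; apply/subsetP => s /bX' /andP [].
  - exists K; split=> //.
    + by apply/subsetP => z /(subsetP KZ) /ZV.
    + rewrite disjoint_sym disjoint_subset; apply/subsetP => z; rewrite in_setU => zX'.
      apply/negP => /(subsetP KZ) zZ; have := zZ; rewrite inZ ?ZV //.
      case/orP: zX' => [|/bX' /andP [+ _]]; last by rewrite in_nbs => /andP [_ ->]; rewrite andbF.
      by rewrite inE => /andP [_ /orP [->|/andP [-> _]]]; rewrite ?andbF.
    + by move=> s /bX' /andP [].
  - by apply: proper_card; rewrite properEneq X'ne.
apply/eqP; rewrite eqEsubset subUset -andbA; apply/and3P; split.
- apply/subsetP => x; rewrite -X'eq inE in_setU1 in_nbs => /andP [xX].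
  by rewrite (subsetP XV x xX) => /orP [->//|/andP [-> _]]; rewrite orbT.
(* A boundary vertex not adjacent to [w] would lie in [K], yet no vertex of [X] now has a neighbour
   in [K]. *)
- apply/subsetP => s sS; have [sV sX [x xX xs]] := boundaryP sS.
  have xX' : x \in X' by rewrite X'eq.
  rewrite in_setU1 in_nbs sV /=; apply: contraT; rewrite negb_or => sw.
  by case: (X'K x s xX' _ xs); apply: S_Z_K; rewrite ?inZ.
- by rewrite subUset sub1set in_setU wX Nw.
Qed.

Hypothesis nbs_neq0 : forall x, x \in V -> nbs e V x != set0.

Lemma no_anchored X : X \subset V -> X != set0 -> #|boundary X| <= 9 -> anchored X -> False.
Proof.
have [n] := ubnP #|X|; elim: n X => // n IHn X Xn XV X0 S9 aX.
have IH X' : X' \subset V -> X' != set0 -> #|boundary X'| <= 9 -> anchored X' ->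
    #|X'| < #|X| -> False.
  by move=> ? ? ? ? lt; apply: (IHn X') => //; apply: leq_trans lt _; rewrite -ltnS.
have [w wX w9] := low_degree_vertex XV X0 S9 aX.
have Ew := smallest_closure XV aX wX w9 IH.
(* Any [x] in [X] has its neighbours in the closure [w |: nbs e V w], so its degree is at most nine
   too. Hence each vertex of [X] is joined to the whole closure. *)
have Ex x : x \in X -> X :|: boundary X = x |: nbs e V x.
  move=> xX; apply: smallest_closure => //.
  have : #|x |: nbs e V x| <= #|w |: nbs e V w|.
    by apply: subset_leq_card; rewrite -Ew subUset sub1set in_setU xX nbs_in_closure.
  by rewrite !cardsU1 !nbs_irr // !add1n ltnS => /leq_trans; apply.
have wV := subsetP XV w wX.
set H := nbs e V w in w9 Ew.
have HV : H \subset V := nbs_sub e V w.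
have wH : w \notin H by exact: nbs_irr.
have NE v : nbs e H v = H :&: nbs e V v.
  by apply/setP => y; rewrite !inE; case: (y \in V).
have wE v : v \in H -> e w v by rewrite in_nbs => /andP [].
have dH v : v \in H -> 5 <= #|nbs e H v|.
  by move=> vH; rewrite NE; exact: (common_ge5 wV (subsetP HV v vH) (wE v vH)).
have H6 : 6 <= #|H|.
  have /set0Pn [x xH] := nbs_neq0 wV.
  exact: leq_ltn_trans (dH x xH) (nbs_lt ie xH).
have [cH|[v vH [nv [s [sz pw sP]]]]] := five_clique_minor_avoiding se ie H6 w9 dH.
  apply: no_K7; apply: (@hasK_le _ #|w |: H|).
    by rewrite cardsU1 wH.
  apply: hasK_clique => //; first by rewrite subUset sub1set wV.
  move=> x y; rewrite !in_setU1 => /orP [/eqP->|xH] /orP [/eqP->|yH]; first by rewrite eqxx.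
  - by move=> _; apply: wE.
  - by move=> _; rewrite se; apply: wE.
  - exact: cH.
have HW : H \subset X :|: boundary X by rewrite Ew subsetUr.
(* Vertices of [X] are universal in [H], so [v] lies on the boundary and touches [Y]. *)
have vS : v \in boundary X.
  have := subsetP HW v vH; rewrite in_setU => /orP [vX|//].
  have /exists_inP [v' v'H /andP [vv' /negP []]] := nv.
  have := subsetP HW v' v'H; rewrite (Ex v vX) in_setU1 in_nbs eq_sym (negPf vv') /=.
  by case/andP.
have [Y [YV cY dY tY]] := aX.
have tv := tY v vS.
have vV := subsetP HV v vH.
have notY x : x \in X :|: boundary X -> x \notin Y.
  by move=> xW; rewrite (disjointFl dY xW).
have sA A : A \in s -> [/\ v \notin A, A \subset H & exists2 x, x \in A & x \in H].
  move=> As; have [A0 AHv _] := sP A As.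
  have AH : A \subset H by apply: subset_trans AHv (subD1set _ _).
  split=> //; first by apply/negP => /(subsetP AHv); rewrite !inE eqxx.
  by case/set0Pn: A0 => x xA; exists x; rewrite ?(subsetP AH).
have wvY : separate_touching e [set w] (v |: Y).
  rewrite separate_touching1 in_setU1 negb_or notY ?in_setU ?wX // andbT.
  rewrite (contraNneq _ wH) => [|-> //]; apply/exists_inP; exists v; rewrite ?setU11 //; exact: wE.
apply: no_K7; exists [:: [set w], v |: Y & s]; split; first by rewrite /= sz.
- rewrite /= pw andbT wvY /=; apply/andP; split; apply/allP => A As; have [vA AH [x xA xH]] := sA A As.
    rewrite separate_touching1 (contra (subsetP AH w)) //=.
    by apply/exists_inP; exists x => //; apply: wE.
  apply/andP; split.
    rewrite disjoint_subset; apply/subsetP => y; rewrite in_setU1 => /orP [/eqP -> //|yY].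
    by apply: contraL yY => /(subsetP AH) /(subsetP HW) /notY.
  (* A vertex of the branch set in [X] is adjacent to [v]; one on the boundary touches [Y]. *)
  have := subsetP HW x xH; rewrite in_setU => /orP [xX|xS].
    apply/touchesP; exists v, x; rewrite setU11; split=> //.
    have := subsetP HW v vH; rewrite (Ex x xX) in_setU1 in_nbs se => /orP [/eqP vx|/andP [] //].
    by rewrite vx xA in vA.
  have := tY x xS; rewrite touches1 => /exists_inP [y yY xy].
  by apply/touchesP; exists y, x; rewrite setU1r // se.
- move=> A; rewrite !in_cons => /or3P [/eqP->|/eqP->|As].
  + split; [by apply/set0Pn; exists w; rewrite set11 | by rewrite sub1set | exact: connected_in1].
  + split; [by apply/set0Pn; exists v; rewrite setU11 | by rewrite subUset sub1set vV | ].
    by apply: connected_inU => //; exact: connected_in1.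
  + have [A0 _ cA] := sP A As; have [_ AH _] := sA A As.
    by split=> //; exact: subset_trans HV.
Qed.

Lemma core_contradiction : V != set0 -> False.
Proof.
move=> V0; have bV : boundary V = set0 by rewrite /boundary setDv; apply/setP => x; rewrite !inE.
apply: (@no_anchored V) => //; first by rewrite bV cards0.
exists set0; rewrite bV; split; rewrite ?sub0set ?disjoints_subset ?sub0set //.
- by move=> x y; rewrite inE.
- by move=> x; rewrite inE.
Qed.

End Core.

(** With [c = 5], [n0 = 5] and [d = 30] this is Mader's bound [5 n - 15], attained by [K_5].
    Minimality supplies the bound for smaller graphs that the separator argument uses. *)
Lemma K7_minor_free_bound (T : finType) (e : rel T) (W : {set T}) :
  symmetric e -> irreflexive e -> 5 <= #|W| -> ~ hasK 7 e W -> esum e W + 30 <= 10 * #|W|.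
Proof.
move=> se ie; apply: (extremal_induction (c := 5)) se ie => // {}e {}W se ie W5 nW tW es bound.
case: (hasKP 7 e W) => // nK; case: (core_contradiction se ie tW _ bound nK nW); first by lia.
by rewrite -card_gt0; apply: leq_trans W5.
Qed.

(** Once the bound is known for all graphs, it supplies both [esum_lt] and [bound], and the
    separator argument runs again. *)
Lemma K7_minor_of_triangles (T : finType) (e : rel T) (W : {set T}) :
  symmetric e -> irreflexive e -> W != set0 ->
  (forall x, x \in W -> nbs e W x != set0) ->
  {in W &, forall x y, e x y -> 5 <= #|nbs e W x :&: nbs e W y|} -> hasK 7 e W.
Proof.
move=> se ie W0 nW tW; case: (hasKP 7 e W) => // nK.
have W5 : 5 <= #|W|.
  have /set0Pn [x xW] := W0; have /set0Pn [y] := nW x xW; rewrite in_nbs => /andP [yW xy].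
  apply: leq_trans (tW x y xW yW xy) _; apply: subset_leq_card.
  by rewrite subIset // nbs_sub.
have B := K7_minor_free_bound se ie W5 nK.
case: (core_contradiction se ie tW _ _ nK nW W0); first by lia.
by move=> e' W' se' ie' W'5 _ nK'; apply: K7_minor_free_bound.
Qed.

(** * Colourings of double-critical graphs *)

Section Colorings.
Variables (T : finType) (e : rel T).
Hypotheses (se : symmetric e) (ie : irreflexive e).
Implicit Types (S : {set T}).

(** Colourings by natural numbers are easy to modify pointwise; the successor provides the non-empty
    palette that [inord] needs. *)
Lemma chi_leP S k :
  reflect (exists f : T -> nat, {in S, forall x, f x < k.+1} /\
             {in S &, forall x y, e x y -> f x != f y})
          (chi e S <= k.+1).
Proof.
apply: (iffP idP) => [le|[f [fk fE]]]; last first.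
  rewrite /chi; case: ex_minnP => m _; apply; apply/existsP; exists [ffun x => inord (f x)].
  apply/forallP => x; apply/forallP => y; apply/implyP => /and4P [xS yS _ xy].
  by rewrite !ffunE; apply: contra (fE x y xS yS xy) => /eqP /(congr1 val); rewrite /= !inordK ?fk // => ->.
move: le; rewrite /chi; case: ex_minnP => m /existsP [f /forallP fP] _ le.
exists (fun x => val (f x)); split=> [x _|x y xS yS xy]; first exact: leq_trans (ltn_ord _) le.
have /forallP /(_ y) := fP x; rewrite xS yS xy /= andbT => /implyP; apply.
by apply: contraTneq xy => ->; rewrite ie.
Qed.

(** A 6-colouring of [G - x] would extend to an isolated [x]. *)
Lemma critical_nbs_neq0 x : critical e -> chi e setT = 7 -> nbs e setT x != set0.
Proof.
move=> /(_ x) crit chi7; rewrite chi7 ltnS in crit.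
have /chi_leP [f [fk fE]] := crit; apply: contra_eqN chi7 => /eqP Nx; rewrite neq_ltn ltnS.
have nx y : e x y = false by apply/negP => xy; have := in_set0 y; rewrite -Nx in_nbs inE xy.
apply/orP; left; apply/chi_leP; exists (fun z => if z == x then 0 else f z); split=> [z _|a b _ _ ab].
  by case: eqVneq => // zx; rewrite fk ?inE ?zx.
have ax : a != x by apply: contraTneq ab => ->; rewrite nx.
have bx : b != x by apply: contraTneq ab => ->; rewrite se nx.
by rewrite (negPf ax) (negPf bx) fE ?inE ?ax ?bx.
Qed.

(* A colour [i] of [G - x - y] missing on the common neighbours is given to [x]; its neighbours
   of colour [i] move, together with [y], to a sixth class. *)
Lemma double_critical_common x y : double_critical e -> chi e setT = 7 -> e x y ->
  5 <= #|nbs e setT x :&: nbs e setT y|.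
Proof.
move=> [_ dc] chi7 xy; have := dc x y xy; rewrite chi7 => /chi_leP [f [fk fE]].
set C := _ :&: _; rewrite leqNgt; apply/negP => C4.
have [i i5 iC] : exists2 i, i < 5 & {in C, forall z, f z != i}.
  have [/hasP [i]|/hasPn h] := boolP (has (fun i => i \notin [seq f z | z <- enum C]) (iota 0 5)).
    rewrite mem_iota => /andP [_ i5] iC; exists i => // z zC.
    by apply: contraNneq iC => <-; apply: map_f; rewrite mem_enum.
  have : size (iota 0 5) <= size [seq f z | z <- enum C].
    by apply: uniq_leq_size (iota_uniq _ _) _ => i /h; rewrite negbK.
  by rewrite size_map -cardE size_iota leqNgt C4.
have xy' : x != y by apply: contraTneq xy => ->; rewrite ie.
have inS z : z != x -> z != y -> z \in [set: T] :\ x :\ y by rewrite !inE => -> ->.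
pose g z := if z == x then i else if z == y then 5 else if (f z == i) && e x z then 5 else f z.
have gx : g x = i by rewrite /g eqxx.
have gy : g y = 5 by rewrite /g eqxx eq_sym (negPf xy').
have gE z : z != x -> z != y -> g z = if (f z == i) && e x z then 5 else f z.
  by move=> /negPf zx /negPf zy; rewrite /g zx zy.
have gx_proper b : e x b -> g x != g b.
  move=> xb; rewrite gx; have [->|bNy] := eqVneq b y; first by rewrite gy ltn_eqF.
  have bx : b != x by apply: contraTneq xb => ->; rewrite ie.
  by rewrite gE // xb andbT; case: (f b =P i) => [_|/eqP]; [rewrite ltn_eqF | rewrite eq_sym].
(* A neighbour of [y] recoloured 5 would be a common neighbour of old colour [i], against the choice
   of [i]. *)
have gy_proper b : e y b -> b != x -> g y != g b.
  move=> yb bx; have bNy : b != y by apply: contraTneq yb => ->; rewrite ie.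
  rewrite gy gE //; case: ifP => [/andP [fb xb]|_]; last by rewrite gtn_eqF // fk // inS.
  by have := iC b; rewrite fb !inE xb yb => /(_ isT).
suff : chi e setT <= 6 by rewrite chi7.
apply/chi_leP; exists g; split=> [z _|a b _ _ ab].
  rewrite /g; case: eqP => [_|/eqP zx]; first exact: ltnW.
  case: eqP => [_ //|/eqP zy]; case: ifP => // _; exact: ltnW (fk z (inS z zx zy)).
have ba : e b a by rewrite se.
have [ax|ax] := eqVneq a x; first by rewrite ax gx_proper -?ax.
have [bx|bx] := eqVneq b x; first by rewrite bx eq_sym gx_proper -?bx.
have [ay|ay] := eqVneq a y; first by rewrite ay gy_proper -?ay.
have [byy|byy] := eqVneq b y; first by rewrite byy eq_sym gy_proper -?byy.
have fab := fE a b (inS a ax ay) (inS b bx byy) ab.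
have fa := fk a (inS a ax ay); have fb := fk b (inS b bx byy).
rewrite !gE //; case: ifP => [/andP [/eqP ia _]|_]; case: ifP => [/andP [/eqP ib _]|_] //.
- by rewrite ia ib eqxx in fab.
- by rewrite gtn_eqF.
- by rewrite ltn_eqF.
Qed.

End Colorings.

Theorem theorem31 (T : finType) (e : rel T) :
  simple_graph e -> double_critical e -> chi e setT = 7 ->
  minor (@complete_rel 7) e.
Proof.
move=> [se ie] dc chi7; apply: (hasK_minor (W := setT)) => //.
have [crit _] := dc; apply: K7_minor_of_triangles => //.
- apply/negP => /eqP T0; suff : chi e setT <= 1 by rewrite chi7.
  by apply/chi_leP => //; exists (fun=> 0); split=> // x y; rewrite T0 inE.
- by move=> x _; apply: critical_nbs_neq0.
- by move=> x y _ _; apply: double_critical_common.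
Qed.
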